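(* Let $(X,\mathbb{R})$ be a topological flow with the small flow boundary property (SFBP), and suppose that there is some $\tau\in\mathbb{R}$ such that $(X,\tau)$ is aperiodic. Then $\mathrm{mdim}(X,\mathbb{R})=0$.
   Context: A topological flow $(X,\mathbb{R})$ is a compact metrizable space $X$ with a continuous action $(t,x)\mapsto tx$ of $\mathbb{R}$. It is fixed-point free if no $x\in X$ satisfies $tx=x$ for all $t\in\mathbb{R}$. For $\tau\in\mathbb{R}$, $(X,\tau)$ denotes the $\mathbb{Z}$-system generated by the homeomorphism $x\mapsto\tau x$ (a time-discretization of the flow); it is aperiodic if there are no $x\in X$ and $n\ge1$ with $(n\tau)x=x$. SFBP: for $A\subset X$ and $s<s'$ write $[s,s']A=\{ta:t\in[s,s'],a\in A\}$. A cross-section with injectivity time $\eta>0$ is a set $S\subset X$ such that $[-\eta,\eta]\times S\to X$, $(t,x)\mapsto tx$, is injective. For a subset $U$ of a closed cross-section with injectivity time $\eta$, the flow interior is $\mathrm{Int}^{\mathbb{R}}U:=\mathrm{Int}([-\eta,\eta]U)\cap U$ (interior in $X$) and the flow boundary is $\partial^{\mathbb{R}}U:=\overline U\setminus\mathrm{Int}^{\mathbb{R}}U$. A set is null if it has measure zero for every $\mathbb{R}$-invariant Borel probability measure on $X$. A closed cross-section $S$ with injectivity time $\eta$ has a small flow boundary if $[-\eta,\eta](\partial^{\mathbb{R}}S)$ is null. The flow has SFBP if it is fixed-point free and for each $x\in X$ and each closed cross-section $S'$ with $x\in\mathrm{Int}^{\mathbb{R}}(S')$ there is a closed subset $S\subset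 S'$ such that $x\in\mathrm{Int}^{\mathbb{R}}(S)$ and $S$ has a small flow boundary. Mean dimension: for a compact metric space $(X,d)$ and $\epsilon>0$, a continuous map $f:X\to K$ is an $\epsilon$-embedding if $f(x_1)=f(x_2)$ implies $d(x_1,x_2)<\epsilon$; $\mathrm{Widim}_\epsilon(X,d)$ is the minimum of the Lebesgue covering dimensions $\dim K$ over compact metrizable $K$ admitting an $\epsilon$-embedding $X\to K$. For a flow, fix a compatible metric $d$, put $d_N(x,y)=\max_{t\in[0,N]}d(tx,ty)$, and $\mathrm{mdim}(X,\mathbb{R})=\lim_{\epsilon\to0}\lim_{N\to\infty}\frac{\mathrm{Widim}_\epsilon(X,d_N)}{N}$ (independent of the choice of $d$). *)

(* Defs.v *)
From HB Require Import structures.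
From mathcomp Require Import all_boot all_order all_algebra.
From mathcomp Require Import all_classical all_reals all_analysis.

Set Implicit Arguments.
Unset Strict Implicit.
Unset Printing Implicit Defensive.

Import Order.TTheory GRing.Theory Num.Theory.
Import numFieldNormedType.Exports.

Local Open Scope classical_set_scope.
Local Open Scope ring_scope.
Local Open Scope card_scope.

Record flow (R : realType) (X : topologicalType) := Flow {
  act :> R -> X -> X ;
  act_continuous : continuous (fun p : R * X => act p.1 p.2) ;
  act0 : forall x, act 0 x = x ;
  actD : forall s t x, act (s + t) x = act s (act t x) }.

(* The library's measurable types are pointed, so the Borel sigma-algebra of
   [X] is formed after choosing a base point.  The sigma-algebra itself does not
   depend on that point; in this way the empty space is not excluded. *)
Definition pointed_at (X : topologicalType) (x0 : X) : Type := X.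

HB.instance Definition _ (X : topologicalType) (x0 : X) :=
  Topological.on (pointed_at x0).
HB.instance Definition _ (X : topologicalType) (x0 : X) :=
  isPointed.Build (pointed_at x0) x0.

Definition borel (X : topologicalType) (x0 : X) :=
  g_sigma_algebraType (@open (pointed_at x0)).

Section small_flow_boundary.
Context {R : realType} {X : topologicalType} (phi : flow R X).

Definition fixed_point_free := ~ exists x, forall t, phi t x = x.

Definition aperiodic (tau : R) :=
  ~ exists (x : X) (n : nat), (1 <= n)%N /\ phi (tau *+ n) x = x.

(* [s, s']A *)
Definition orbit_segments (s s' : R) (A : set X) : set X :=
  [set phi t a | t in `[s, s'] & a in A].

Definition cross_section (eta : R) (S : set X) :=
  0 < eta /\
  set_inj (`[- eta, eta] `*` S) (fun p : R * X => phi p.1 p.2).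

Definition closed_cross_section (eta : R) (S : set X) :=
  closed S /\ cross_section eta S.

Definition flow_interior (eta : R) (U : set X) : set X :=
  interior (orbit_segments (- eta) eta U) `&` U.

Definition flow_boundary (eta : R) (U : set X) : set X :=
  closure U `\` flow_interior eta U.

Definition invariant_measure (x0 : X) (mu : probability (borel x0) R) :=
  forall (t : R) (A : set (borel x0)), measurable A -> mu (phi t @^-1` A) = mu A.

Definition null (A : set X) :=
  forall (x0 : X) (mu : probability (borel x0) R),
    invariant_measure mu -> mu.-negligible (A : set (borel x0)).

Definition has_small_flow_boundary (eta : R) (S : set X) :=
  null (orbit_segments (- eta) eta (flow_boundary eta S)).

(* A subset of a cross-section with injectivity time [eta] is again one; the
   flow interior, the flow boundary and the nullity of the orbit segments of the
   latter do not depend on the choice of an injectivity time. *)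
Definition SFBP :=
  fixed_point_free /\
  forall (x : X) (eta : R) (S' : set X),
    closed_cross_section eta S' -> flow_interior eta S' x ->
    exists S : set X, [/\ closed S, S `<=` S', flow_interior eta S x &
                          has_small_flow_boundary eta S].

End small_flow_boundary.

Section dimension.
Context {R : realType}.

Definition open_cover (K : topologicalType) (U : set (set K)) :=
  U `<=` open /\ \bigcup_(u in U) u = setT.

(* Every point lies in at most [m] members of [V]. *)
Definition cover_order_le (K : topologicalType) (V : set (set K)) (m : nat) :=
  forall x, [set v | V v /\ v x] #<= `I_m.

Definition refines (K : topologicalType) (V U : set (set K)) :=
  forall v, V v -> exists2 u, U u & v `<=` u.

(* Lebesgue covering dimension; it is -1 for the empty space and +oo when the
   orders of the refinements cannot be bounded. *)
Definition covering_dim (K : topologicalType) : \bar R :=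
  ereal_inf [set (m%:R - 1)%:E | m in [set m : nat |
    forall U : set (set K), open_cover U ->
      exists V, [/\ open_cover V, refines V U & cover_order_le V m]]].

Definition eps_embedding (X : Type) (d : X -> X -> R) (eps : R)
    (K : Type) (f : X -> K) :=
  forall x1 x2, f x1 = f x2 -> d x1 x2 < eps.

Definition Widim (X : topologicalType) (d : X -> X -> R) (eps : R) : \bar R :=
  ereal_inf [set e | exists (K : metricType R) (f : X -> K),
    [/\ compact [set: K], continuous f, eps_embedding d eps f &
        e = covering_dim K]].

Context {X : metricType R} (phi : flow R X).

Definition dist_upto (N : R) (x y : X) : R :=
  sup [set mdist (phi t x) (phi t y) | t in `[0, N]].

(* [mdim_is l]: the iterated limit defining the mean dimension, with respect to
   the metric [mdist] of [X], exists and equals [l].  A relation is used because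
   [lim] takes the default value 0 when there is no limit. *)
Definition mdim_is (l : \bar R) :=
  exists2 w : R -> \bar R,
    forall eps : R, 0 < eps ->
      (Widim (dist_upto N) eps * (N^-1)%:E)%E @[N --> +oo%R] --> w eps &
    w eps @[eps --> 0^'+] --> l.

End dimension.

(* Main.v *)
(* The orbit of a point over [0, N] is coded by its visits to finitely many small
   closed cross-sections with small flow boundaries.  The sections are shrunk in
   one of [D + 1] ways ("colours"), by discarding the points at distance less
   than a threshold q_j from the flow boundary; a colour is bad at x if the orbit
   of x meets a section exactly at distance q_j.  Between two hits the orbits of
   points with the same itinerary drift apart by a small amount only, and the
   drift is reset once per window of length L by cutting the time axis at
   points depending on the colour; the hits close to the beginnings of the
   windows may fall on such a cut and make the colour bad as well.  Since the
   thresholds and the cuts of different colours are disjoint, every visit spoils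
   at most one colour.  As the flow boundaries are null, the orbit spends a
   proportion of time close to them that is uniformly small (otherwise an
   ultrafilter limit of empirical measures would be an invariant measure charging
   a flow boundary), so with D of the order of delta N some colour is good at each
   point.  For each colour, classes of points linked by fine chains of good points
   are open, disjoint and small for [d_N].  The D + 1 families of classes thus
   give an open cover of order at most D + 1 and hence an eps-embedding into a
   space of dimension at most D. *)
Require Import Defs.
From HB Require Import structures.
From mathcomp Require Import all_boot all_order all_algebra.
From mathcomp Require Import all_classical all_reals all_analysis.
From mathcomp Require Import measurable_realfun lra ring zify.
Import Order.TTheory GRing.Theory Num.Theory.
Import numFieldNormedType.Exports.
Set Implicit Arguments.
Unset Strict Implicit.
Unset Printing Implicit Defensive.
Local Open Scope classical_set_scope.
Local Open Scope ring_scope.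

(** * Compactness in metric spaces *)

Lemma nbhs_mdistE (R : realType) (T : metricType R) (x : T) (P : set T) :
  nbhs x P <-> exists2 e : R, 0 < e & forall y, mdist x y < e -> P y.
Proof.
rewrite nbhs_ballP; split=> -[e e0 eP]; exists e => //.
  by move=> y xy; apply: eP; rewrite ballEmdist.
by move=> y; rewrite ballEmdist => /eP.
Qed.

Lemma mdist_cont (R : realType) (T : topologicalType) (U : metricType R) (f : T -> U) (x : T) :
  {for x, continuous f} <->
  forall e : R, 0 < e -> \forall y \near x, mdist (f x) (f y) < e.
Proof.
split=> [fx e e0|fx A /nbhs_mdistE [e e0 eA]].
  by apply: (fx [set z | mdist (f x) z < e]); apply/nbhs_mdistE; exists e.
by apply: filterS (fx _ e0) => y; exact: eA.
Qed.

(** Near-covering compactness, applied with the filter of positive reals close to 0, turns radii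
    valid near each point of [K] into one radius for all of [K]. Most uniform radii below come from
    here. *)
Lemma compact_small (R : realType) (T : topologicalType) (K : set T)
    (Q : R -> T -> Prop) : compact K ->
  (forall x, K x -> exists2 e : R, 0 < e &
    \forall y \near x, forall r, 0 < r -> r <= e -> Q r y) ->
  exists2 e : R, 0 < e & forall y r, K y -> 0 < r -> r <= e -> Q r y.
Proof.
move=> /compact_near_coveringP cK KQ.
have := cK R (0^'+) Q _; case.
  move=> x /KQ [e e0 exQ].
  near=> y r => /=.
  have : forall r, 0 < r -> r <= e -> Q r y by near: y.
  apply; first by near: r; exact: nbhs_right_gt.
  by near: r; exact: nbhs_right_le.
(* The filter provides a strict bound [r < e]; halving allows [r <= e]. *)
move=> e /= e0 He; exists (e / 2); first by rewrite divr_gt0.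
move=> y r Ky r0 re; apply: He => //=.
by rewrite sub0r normrN gtr0_norm// (le_lt_trans re)// ltr_pdivrMr// ltr_pMr// ltr1n.
Unshelve. all: by end_near. Qed.

Lemma finite_subcover (T : topologicalType) (K : set T) (V : set (set T)) :
  compact K -> V `<=` open -> K `<=` \bigcup_(v in V) v ->
  exists s : seq (set T), (forall v, v \in s -> V v) /\
    forall x, K x -> exists2 v, v \in s & v x.
Proof.
move=> cK Vo KV.
have [->|/set0P [x0 Kx0]] := eqVneq K set0.
  by exists [::]; split => // x [].
have : @cover_compact (pointed_at x0) K by rewrite -compact_cover.
move=> /(_ (set T) V id Vo KV) [D DV KD].
exists (finmap.enum_fset D); split => [v vD|x /KD [v /= vD vx]]; last by exists v.
by have := DV v vD; rewrite in_setE.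
Qed.

Lemma finite_nbhs_cover (T : topologicalType) (K : set T) (N : T -> set T) :
  compact K -> (forall x, K x -> nbhs x (N x)) ->
  exists s : seq T, (forall x, x \in s -> K x) /\
    forall x, K x -> exists2 y, y \in s & N y x.
Proof.
move=> cK KN.
have [->|/set0P [x0 Kx0]] := eqVneq K set0.
  by exists [::]; split => // x [].
have : @cover_compact (pointed_at x0) K by rewrite -compact_cover.
move=> /(_ T K (fun x => (N x)^°)) [].
- by move=> x _; exact: open_interior.
- by move=> x Kx; exists x => //; exact: KN.
move=> D DK KD.
exists (finmap.enum_fset D); split => [v vD|x /KD [v /= vD vx]].
  by have := DK v vD; rewrite in_setE.
by exists v => //; exact: interior_subset vx.
Qed.

(** * Covering dimension of skeletons of cubes *)

(** Membership is made boolean so that points with equal coordinates are equal. The metric given to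
    it below is the maximum metric. *)
Definition cube_subspace (R : realType) (I : finType) (A : set {ffun I -> R}) :=
  {p : {ffun I -> R} | `[< A p >]}.

Section cube_metric.
Variables (R : realType) (I : finType) (A : set {ffun I -> R}).
Local Notation K := (cube_subspace A).

HB.instance Definition _ := Choice.on K.

Let dist (p q : K) : R := \big[Num.max/0]_i `|sval p i - sval q i|.

Let dist_ge0 (p q : K) : 0 <= dist p q.
Proof. by rewrite /dist; elim/big_ind: _ => // x y x0 y0; rewrite le_max x0. Qed.

Let dist_le (p q : K) (e : R) : 0 <= e -> (forall i, `|sval p i - sval q i| <= e) -> dist p q <= e.
Proof. by move=> e0 pq; apply: bigmax_le. Qed.

Let le_dist (p q : K) i : `|sval p i - sval q i| <= dist p q.
Proof. exact: (le_bigmax 0 (fun i => `|sval p i - sval q i|)). Qed.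

Let distxx (p : K) : dist p p = 0.
Proof.
by apply/eqP; rewrite eq_le dist_ge0 andbT dist_le// => i; rewrite subrr normr0.
Qed.

Let dist_positivity (p q : K) : dist p q = 0 -> p = q.
Proof.
move=> pq; apply/val_inj/ffunP => i; apply/eqP; rewrite -subr_eq0 -normr_le0.
by rewrite -pq le_dist.
Qed.

Let dist_sym (p q : K) : dist p q = dist q p.
Proof. by apply: eq_bigr => i _; rewrite distrC. Qed.

Let dist_triangle (q p r : K) : dist p r <= dist p q + dist q r.
Proof.
apply: dist_le; first by rewrite addr_ge0.
move=> i; rewrite (le_trans (ler_distD (sval q i) _ _))// lerD//.
Qed.

HB.instance Definition _ :=
  isMetric.Build R K distxx dist_positivity dist_sym dist_triangle.

Lemma cube_mdist_lt (p q : K) (e : R) : 0 < e ->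
  (forall i, `|sval p i - sval q i| < e) -> mdist p q < e.
Proof. by move=> e0 pq; apply: bigmax_lt. Qed.

Lemma le_cube_mdist (p q : K) i : `|sval p i - sval q i| <= mdist p q.
Proof. exact: le_dist. Qed.

End cube_metric.

Lemma lebesgue_number (R : realType) (K : metricType R) (U : set (set K)) :
  compact [set: K] -> open_cover U ->
  exists2 e : R, 0 < e & forall x, exists2 u, U u & forall y, mdist x y < e -> u y.
Proof.
move=> cK [Uo UT].
have [|e e0 eP] := @compact_small R K setT
    (fun r x => exists2 u, U u & forall y, mdist x y < r -> u y) cK.
  move=> x _.
  have : (\bigcup_(u in U) u) x by rewrite UT.
  case=> u Uu ux.
  have /nbhs_mdistE [e e0 eu] : nbhs x u by apply: open_nbhs_nbhs; split=> //; exact: Uo.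
  exists (e / 2); first by rewrite divr_gt0.
  apply/nbhs_mdistE; exists (e / 2); first by rewrite divr_gt0.
  move=> y xy r r0 re; exists u => // z yz; apply: eu.
  rewrite (le_lt_trans (metric_triangle _ y _))// [ltRHS]splitr ltrD//.
  exact: lt_le_trans yz re.
by exists e => // x; exact: eP.
Qed.

(* Colour [j] cuts every coordinate axis at the points [(z + r_j) / k], [z] an
   integer, with distinct [r_j] strictly between 0 and 1.  A coordinate equal to
   0 or 1 is never cut, and any other coordinate is cut by at most one colour,
   so that a point with at most [D] such coordinates is missed by one of the
   [D + 1] colours. *)
Lemma covering_dim_cube (R : realType) (I : finType) (A : set {ffun I -> R})
    (D : nat) : compact [set: cube_subspace A] ->
  (forall p, A p -> #|[pred i | (p i != 0%R) && (p i != 1%R)]| <= D)%N ->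
  (@covering_dim R (cube_subspace A) <= D%:R%:E)%E.
Proof.
set K := cube_subspace A => cK AD.
apply: ereal_inf_lbound; exists D.+1; last by rewrite -natr1 addrK.
move=> U Uc.
have [e e0 eU] := lebesgue_number cK Uc.
(* Boxes of side [1 / k] are smaller than the Lebesgue number [e]. *)
pose k : nat := (Num.truncn e^-1).+1.
have ke : k%:R^-1 < e.
  by rewrite -[ltRHS]invrK ltf_pV2 ?posrE ?invr_gt0 ?ltr0n// truncnS_gt.
pose r (j : 'I_D.+1) : R := (j.+1)%:R / D.+2%:R.
have r0 j : 0 < r j by rewrite divr_gt0// ltr0n.
have r1 j : r j < 1.
  by rewrite ltr_pdivrMr ?ltr0n// mul1r ltr_nat ltnS; exact: ltn_ord.
have rinj : injective r.
  move=> i j /(congr1 (fun x => x * D.+2%:R)); rewrite /r !divfK ?pnatr_eq0//.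
  by move/eqP; rewrite eqr_nat eqSS => /eqP/val_inj.
clearbody r.
have intlt (a : int) : -1 < a%:~R :> R -> a%:~R < 1 :> R -> a = 0.
  by rewrite -[-1]/((-1)%:~R) -[1]/(1%:~R) !ltr_int; lia.
pose box j (z : I -> int) : set K := [set p : K | forall i,
  (z i - 1)%:~R + r j < k%:R * sval p i < (z i)%:~R + r j].
(* Empty boxes are dropped, since placing a box inside a member of [U] starts from one of its
   points. *)
pose V := [set v | (exists j z, v = box j z) /\ v !=set0].
have Vop : V `<=` open.
  move=> _ [[j [z ->]] _]; rewrite openE => p pv.
  apply: (@filter_forall K I (fun i (q : K) =>
    (z i - 1)%:~R + r j < k%:R * sval q i < (z i)%:~R + r j) (nbhs p)) => i.
  have /andP[lo hi] := pv i.
  pose m := Num.min (k%:R * sval p i - ((z i - 1)%:~R + r j))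
              ((z i)%:~R + r j - k%:R * sval p i).
  have m0 : 0 < m by rewrite lt_min !subr_gt0 lo hi.
  apply/nbhs_mdistE; exists (m / k%:R) => [|q pq]; first by rewrite divr_gt0// ltr0n.
  have : `|k%:R * (sval p i - sval q i)| < m.
    rewrite normrM gtr0_norm ?ltr0n// mulrC -ltr_pdivlMr ?ltr0n//.
    exact: le_lt_trans (le_cube_mdist p q i) pq.
  rewrite lt_min mulrBr !ltr_norml => /andP[/andP[a b] /andP[c d]].
  by apply/andP; split; lra.
exists V; split.
- split=> //; apply/seteqP; split=> // p _.
  (* Pigeonhole: if every colour cut a coordinate of [p], choosing such a coordinate would be an
     injection of the [D.+1] colours into the coordinates different from 0 and 1. *)
  have [j jP] : exists j, forall i (z : int), k%:R * sval p i != z%:~R + r j.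
    apply: contrapT => H.
    have /choice [c cP] : forall j, exists i, exists z : int,
        k%:R * sval p i = z%:~R + r j.
      move=> j; apply: contrapT => Hj; apply: H; exists j => i z.
      by apply/negP => /eqP E; apply: Hj; exists i, z.
    have cinj : injective c.
      move=> j j' cj; have [z E] := cP j; have [z' E'] := cP j'.
      apply: rinj; move: E; rewrite cj E' => E.
      have F : (z - z')%:~R = r j' - r j by rewrite intrB; lra.
      have : z - z' = 0.
        by apply: intlt; rewrite F; have := r0 j; have := r0 j';
          have := r1 j; have := r1 j'; lra.
      by move=> G; move: F; rewrite G; lra.
    have : (D.+1 <= #|[pred i | (sval p i != 0%R) && (sval p i != 1%R)]|)%N.
      rewrite -[X in (X <= _)%N]card_ord -(card_codom cinj).
      apply/subset_leq_card/fintype.subsetP => _ /codomP [j ->]; rewrite inE.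
      have [z E] := cP j; apply/andP; split; apply/eqP => F; move: E; rewrite F.
        rewrite mulr0 => /esym/eqP; rewrite addr_eq0 => /eqP E.
        have z0 : z = 0 by apply: intlt; rewrite E; have := r0 j; have := r1 j; lra.
        by move: E; rewrite z0 => /eqP; rewrite eq_sym oppr_eq0 gt_eqF.
      rewrite mulr1 => E.
      have G : (k%:Z - z)%:~R = r j :> R by rewrite intrB -pmulrn; lra.
      have : k%:Z - z = 0 by apply: intlt; rewrite G; have := r0 j; have := r1 j; lra.
      by move=> G'; move: G; rewrite G'; have := r0 j; lra.
    by rewrite leqNgt ltnS AD//; case: p {H c cP cinj} => p /= /asboolP.
  pose z i := Num.floor (k%:R * sval p i - r j) + 1.
  have pz : box j z p.
    move=> i; have := jP i (Num.floor (k%:R * sval p i - r j)).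
    have /andP[] := floor_itv (k%:R * sval p i - r j).
    rewrite /z addrK le_eqVlt => /orP[/eqP->|lo hi _]; first by rewrite subrK eqxx.
    by apply/andP; split; lra.
  by exists (box j z) => //; split; [exists j, z|exists p].
- move=> v [[j [z ->]] [p pv]]; have [u Uu pu] := eU p.
  exists u => // q qv; apply: pu; apply: cube_mdist_lt => // i.
  apply: lt_trans ke.
  have /andP[p1 p2] := pv i; have /andP[q1 q2] := qv i.
  move: p1 q1; rewrite intrB => p1 q1.
  rewrite -(ltr_pM2l (_ : 0 < k%:R)) ?ltr0n// divff ?pnatr_eq0//.
  rewrite -[X in X * _]gtr0_norm ?ltr0n// -normrM mulrBr ltr_norml.
  by apply/andP; split; lra.
- move=> p.
  (* Boxes of one colour that share a point coincide, so the colour is injective on the members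
     containing [p]. *)
  have /choice [c cP] : forall v, exists j : 'I_D.+1, V v -> exists z, v = box j z.
    move=> v; have [[[j vj] _]|nV] := pselect (V v); first by exists j.
    by exists ord0.
  suff : $|{injfun [set v | V v /\ v p] >-> `I_D.+1}| by case=> f; exact: inj_card_le f.
  apply/injfunPex; exists (fun v => val (c v)); first by move=> v _ /=; exact: ltn_ord.
  move=> v w /set_mem /= [Vv vp] /set_mem /= [Vw wp] /val_inj E.
  have [z vz] := cP v Vv; have [z' wz] := cP w Vw.
  rewrite vz wz -E; congr box; apply/funext => i.
  move: vp wp; rewrite vz wz -E => /(_ i)/andP[a b] /(_ i)/andP[a' b'].
  have : z i - z' i = 0.
    by move: a b a' b'; rewrite !intrB => *; apply: intlt; rewrite intrB; lra.
  lia.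
Qed.

(** * Width dimension from coloured covers *)

Section truncated_distance.
Variables (R : realType) (X : metricType R).
Implicit Types (A : set X) (x y : X).

(* Truncation at 1 makes the infimum meaningful for [A = set0]. *)
Definition tdist A x : R := inf (1 |` [set mdist x z | z in A]).

Let lb0 A x : lbound (1 |` [set mdist x z | z in A]) 0.
Proof. by move=> _ [->//|[z _ <-]]; exact: mdist_ge0. Qed.

Let hlb A x : has_lbound (1 |` [set mdist x z | z in A]).
Proof. by exists 0; exact: lb0. Qed.

Let ne A x : 1 |` [set mdist x z | z in A] !=set0.
Proof. by exists 1; left. Qed.

Lemma tdist_ge0 A x : 0 <= tdist A x.
Proof. by apply: lb_le_inf; [exact: ne|exact: lb0]. Qed.

Lemma tdist_le1 A x : tdist A x <= 1.
Proof. by apply: ge_inf; [exact: hlb|left]. Qed.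

Lemma tdist_le A x z : A z -> tdist A x <= mdist x z.
Proof. by move=> Az; apply: ge_inf; [exact: hlb|right; exists z]. Qed.

Lemma tdist_lt A x (e : R) : e <= 1 -> tdist A x < e ->
  exists2 z, A z & mdist x z < e.
Proof.
move=> e1 /inf_lt - /(_ (ne _ _)) [_ [->|[z Az <-]]] ze; last by exists z.
by move: (lt_le_trans ze e1); rewrite ltxx.
Qed.

Lemma tdist_lipschitz A x y : `|tdist A x - tdist A y| <= mdist x y.
Proof.
wlog : x y / tdist A y <= tdist A x => [H|yx].
  have [/H//|/ltW/H] := leP (tdist A y) (tdist A x).
  by rewrite distrC metric_sym.
rewrite ger0_norm ?subr_ge0// lerBlDl -lerBlDr.
apply: lb_le_inf => [|_ [->|[z Az <-]]]; first exact: ne.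
  by rewrite lerBlDr (le_trans (tdist_le1 _ _))// lerDl mdist_ge0.
rewrite lerBlDr addrC (le_trans (tdist_le _ Az))//.
exact: metric_triangle.
Qed.

Lemma tdist_gt0 A x : closed A -> ~ A x -> 0 < tdist A x.
Proof.
move=> cA nAx.
have /nbhs_mdistE [e e0 eA] : nbhs x (~` A).
  by apply: open_nbhs_nbhs; split => //; exact: closed_openC.
rewrite (@lt_le_trans _ _ (Num.min 1 e))// ?lt_min ?ltr01//.
apply: lb_le_inf => [|_ [->|[z Az <-]]]; first exact: ne.
  by rewrite ge_min lexx.
by rewrite ge_min orbC leNgt; apply/orP; left; apply/negP => /eA.
Qed.

Lemma tdist_eq0 A x : A x -> tdist A x = 0.
Proof.
move=> Ax; apply/eqP; rewrite eq_le tdist_ge0 andbT.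
by rewrite -(mdistxx x) tdist_le.
Qed.

End truncated_distance.

Lemma lipschitz_cont (R : realType) (X : metricType R) (h : X -> R) :
  (forall x y, `|h x - h y| <= mdist x y) -> continuous h.
Proof.
move=> hl x; apply/(@cvgrPdist_lt _ R^o) => e e0.
by apply/nbhs_mdistE; exists e => // y; exact: le_lt_trans.
Qed.

Lemma bigmax_lipschitz (R : realType) (I : finType) (h h' : I -> R) (e : R) :
  0 <= e -> (forall i, `|h i - h' i| <= e) ->
  `|\big[Num.max/0]_i h i - \big[Num.max/0]_i h' i| <= e.
Proof.
move=> e0.
have H (k k' : I -> R) : (forall i, `|k i - k' i| <= e) ->
    \big[Num.max/0]_i k i <= \big[Num.max/0]_i k' i + e.
  move=> kk'; apply: bigmax_le => [|i _].
    by rewrite addr_ge0//; exact: bigmax_ge_id.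
  rewrite (@le_trans _ _ (k' i + e))//.
    by have := kk' i; rewrite ler_norml => /andP[_]; rewrite lerBlDl.
  by rewrite lerD2r; exact: (le_bigmax 0 k').
move=> hh'; rewrite ler_distl lerBlDr; apply/andP; split; apply: H => // i.
by rewrite distrC.
Qed.

(* The map to the nerve, normalized by its largest coordinate instead of the
   sum, has at every point a coordinate equal to 1 and, besides it, at most [D]
   nonzero ones. *)
Lemma Widim_coloured_cover (R : realType) (X : metricType R) (d : X -> X -> R)
    (eps : R) (D : nat) (V : 'I_D.+1 -> set (set X)) :
  compact [set: X] ->
  (forall j v, V j v -> open v) ->
  (forall j v w x, V j v -> V j w -> v x -> w x -> v = w) ->
  (forall x, exists j, exists2 v, V j v & v x) ->
  (forall j v x y, V j v -> v x -> v y -> d x y < eps) ->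
  (Widim d eps <= D%:R%:E)%E.
Proof.
move=> cX Vo Vdisj Vcov Vd.
have [||s [sV sX]] := @finite_subcover X setT (\bigcup_j V j) cX.
- by move=> v [j _ Vv]; exact: Vo Vv.
- by move=> x _; have [j [v Vv vx]] := Vcov x; exists v => //; exists j.
(* Without duplicates, distinct indices give distinct sets, as counting by colours requires. *)
pose u := undup s; pose I := 'I_(size u).
pose v (i : I) := nth set0 u i.
have vV i : exists j, V j (v i).
  have [|j _ Vj] := sV (v i); last by exists j.
  by rewrite -mem_undup mem_nth.
have vinj : injective v.
  by move=> i j /eqP; rewrite nth_uniq ?undup_uniq// => /eqP/val_inj.
have vcov x : exists i, v i x.
  have [w ws wx] := sX x Logic.I.
  have wu : (index w u < size u)%N by rewrite index_mem mem_undup.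
  by exists (Ordinal wu); rewrite /v/= nth_index ?mem_undup.
have /choice [col colP] := vV.
pose h (i : I) x := tdist (~` v i) x.
have hv i x : (0 < h i x) = (x \in v i).
  apply/idP/idP => [h0|/set_mem vx].
    apply/mem_set; apply: contrapT => nv; move: h0.
    by rewrite /h tdist_eq0// ltxx.
  apply: tdist_gt0; last by rewrite /setC/=; apply.
  by apply: open_closedC; exact: Vo (colP i).
pose m x := \big[Num.max/0]_i h i x.
have m0 x : 0 < m x.
  have [i vix] := vcov x; rewrite (@lt_le_trans _ _ (h i x))//.
    by rewrite hv; exact: mem_set.
  exact: (le_bigmax 0 (fun i => h i x)).
pose f x := [ffun i => h i x / m x].
pose A := range f.
pose F (x : X) : cube_subspace A := exist _ (f x) (asboolT (ex_intro2 _ _ x Logic.I erefl)).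
have hc i : continuous (h i) by apply: lipschitz_cont => x y; exact: tdist_lipschitz.
have mc : continuous m.
  apply: lipschitz_cont => x y; apply: bigmax_lipschitz; first exact: mdist_ge0.
  by move=> i; exact: tdist_lipschitz.
have Fc : continuous F.
  move=> x; apply/mdist_cont => e e0.
  have H : \forall y \near x, forall i : I, `|f x i - f y i| < e.
    apply: (@filter_forall X I (fun i y => `|f x i - f y i| < e) (nbhs x)) => i.
    have fc : (fun y => h i y / m y) y @[y --> x] --> h i x / m x.
      by apply: cvgM; [exact: hc|apply: cvgV; [rewrite gt_eqF|exact: mc]].
    move/(@cvgrPdist_lt _ R^o) : fc => /(_ e e0).
    by apply: filterS => y; rewrite !ffunE.
  by apply: filterS H => y H; apply: cube_mdist_lt.
have cK : compact [set: cube_subspace A].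
  have -> : [set: cube_subspace A] = F @` setT.
    apply/seteqP; split=> // -[p Ap] _.
    have [x _ xp] : A p by exact/asboolP.
    by exists x => //; apply: val_inj.
  by apply: continuous_compact => //; exact: continuous_subspaceT.
have fD p : A p -> (#|[pred i | (p i != 0%R) && (p i != 1%R)]| <= D)%N.
  move=> [x _ <-].
  have [i0 fi0] : exists i, f x i = 1.
    apply: contrapT => H; suff : m x < m x by rewrite ltxx.
    apply: bigmax_lt => // i _; rewrite lt_neqAle; apply/andP; split.
      apply/eqP => hm; apply: H; exists i.
      by rewrite ffunE hm divff// gt_eqF.
    exact: (le_bigmax 0 (fun i => h i x)).
  (* Sets of one colour that contain [x] are equal, so [col] is injective on the nonzero
     coordinates; removing [i0], whose value is 1, leaves at most [D]. *)
  pose N := [set i | f x i != 0]%SET.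
  have : (#|N| <= D.+1)%N.
    rewrite -[X in (_ <= X)%N]card_ord.
    rewrite -(@card_in_imset _ _ col N) ?max_card// => i j.
    have fN k : k \in N -> v k x.
      rewrite inE ffunE mulf_eq0 negb_or => /andP[hk _]; apply: set_mem.
      by rewrite -hv lt_neqAle eq_sym hk tdist_ge0.
    move=> /fN vi /fN vj ij; apply: vinj.
    by apply: (Vdisj (col i) _ _ x) => //; rewrite ij.
  rewrite (cardsD1 i0) inE fi0 oner_eq0/= ltnS => /(leq_trans _); apply.
  apply/subset_leq_card/fintype.subsetP => i; rewrite !inE => /andP[fi /negP fi1].
  by rewrite fi andbT; apply/negP => /eqP ii0; apply: fi1; rewrite ii0 fi0.
apply: le_trans (covering_dim_cube cK fD).
apply: ereal_inf_lbound; exists (cube_subspace A), F; split => // x y.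
move=> /(congr1 (@sval _ _))/= fxy.
have [i vix] := vcov x.
apply: (Vd (col i) (v i)) => //.
apply: set_mem; rewrite -hv.
have : 0 < f x i by rewrite ffunE divr_gt0// hv; exact: mem_set.
by rewrite fxy ffunE pmulr_lgt0// invr_gt0.
Qed.

(** * Flows on compact metric spaces *)

Section compact_flow.
Variables (R : realType) (X : metricType R) (cX : compact [set: X]).
Variable phi : flow R X.

Lemma flowK t x : phi (- t) (phi t x) = x.
Proof. by rewrite -actD addNr act0. Qed.

Lemma flowNK t x : phi t (phi (- t) x) = x.
Proof. by rewrite -actD subrr act0. Qed.

Lemma flow_near t x (e : R) : 0 < e -> exists2 r : R, 0 < r &
  forall s y, `|t - s| < r -> mdist x y < r -> mdist (phi t x) (phi s y) < e.
Proof.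
move=> e0.
have [[/= A B] [/nbhs_ballP[a /= a0 aA] /nbhs_mdistE[b b0 bB]] AB] :=
  (iffLR (mdist_cont _ _) (@act_continuous _ _ phi (t, x))) e e0.
exists (Num.min a b); first by rewrite lt_min a0.
move=> s y; rewrite !lt_min => /andP[ts _] /andP[_ xy].
by apply: (AB (s, y)); split; [exact: aA|exact: bB].
Qed.

Lemma flow_cont t : continuous (phi t).
Proof.
move=> x; apply/mdist_cont => e e0.
have [r r0 rP] := flow_near t x e0.
by apply/nbhs_mdistE; exists r => // y; apply: rP; rewrite subrr normr0.
Qed.

Lemma orbit_cont x : continuous (phi^~ x : R -> X).
Proof.
move=> t; apply/mdist_cont => e e0.
have [r r0 rP] := flow_near t x e0.
apply/nbhs_ballP; exists r => // s ts.
by apply: rP => //; rewrite mdistxx.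
Qed.

Lemma flow_equicont (T e : R) : 0 < e -> exists2 r : R, 0 < r &
  forall t x y, `|t| <= T -> mdist x y < r -> mdist (phi t x) (phi t y) < e.
Proof.
move=> e0.
have cK : compact (`[- T, T]%classic `*` [set: X]).
  by apply: compact_setX => //; exact: segment_compact.
have [|r r0 rP] := @compact_small R _ _ (fun r (p : R * X) =>
    forall y, mdist p.2 y < r -> mdist (phi p.1 p.2) (phi p.1 y) < e) cK.
  move=> [t x] _ /=.
  have [r r0 rP] := flow_near t x (divr_gt0 e0 (ltr0Sn R 1)).
  exists (r / 2); first by rewrite divr_gt0.
  have r20 : 0 < r / 2 by rewrite divr_gt0.
  exists (ball t r, [set y | mdist x y < r / 2]) => /=.
    by split; [exact: nbhsx_ballx|apply/nbhs_mdistE; exists (r / 2)].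
  move=> [s z] /= [ts xz] q q0 qr y zy.
  have xz' : mdist x z < r by rewrite (lt_trans xz)// ltr_pdivrMr// ltr_pMr// ltr1n.
  have xy' : mdist x y < r.
    rewrite (le_lt_trans (metric_triangle _ z _))// [ltRHS]splitr ltrD//.
    exact: lt_le_trans zy qr.
  rewrite [ltRHS]splitr (le_lt_trans (metric_triangle _ (phi t x) _))// ltrD ?rP//.
  by rewrite metric_sym rP.
exists r => // t x y tT xy; apply: (rP (t, x) r) => //.
by split => //=; rewrite in_itv/= -ler_norml.
Qed.

Lemma flow_time_cont (e : R) : 0 < e -> exists2 r : R, 0 < r &
  forall t x, `|t| < r -> mdist (phi t x) x < e.
Proof.
move=> e0.
have [|r r0 rP] := @compact_small R _ _ (fun r (x : X) =>
    forall t, `|t| < r -> mdist (phi t x) x < e) cX.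
  move=> x _.
  have [r r0 rP] := flow_near 0 x (divr_gt0 e0 (ltr0Sn R 1)).
  exists r => //; apply/nbhs_mdistE.
  exists (Num.min r (e / 2)); first by rewrite lt_min r0 divr_gt0.
  move=> y; rewrite lt_min => /andP[xy xy'] q q0 qr t tq.
  rewrite [ltRHS]splitr (le_lt_trans (metric_triangle _ x _))// ltrD//.
  by rewrite metric_sym -{1}(act0 phi x) rP// sub0r normrN (lt_le_trans tq).
by exists r => // t x; apply: rP.
Qed.

Lemma compact_open_nbhs (K O : set X) : compact K -> open O -> K `<=` O ->
  exists2 r : R, 0 < r & forall x y, K x -> mdist x y < r -> O y.
Proof.
move=> cK oO KO.
have [|r r0 rP] := @compact_small R _ _ (fun r (x : X) =>
    forall y, mdist x y < r -> O y) cK.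
  move=> x /KO Ox.
  have /nbhs_mdistE [r r0 rO] : nbhs x O by exact: open_nbhs_nbhs.
  have r20 : 0 < r / 2 by rewrite divr_gt0.
  exists (r / 2) => //; apply/nbhs_mdistE; exists (r / 2) => //.
  move=> y xy q q0 qr z yz; apply: rO.
  rewrite (le_lt_trans (metric_triangle _ y _))// [ltRHS]splitr ltrD//.
  exact: lt_le_trans yz qr.
by exists r => // x y Kx; apply: (rP x r).
Qed.

Lemma closed_sub_compact (K : set X) : closed K -> compact K.
Proof. by move=> cK; apply: subclosed_compact cX _. Qed.

Section cross_section.
Variables (eta : R) (S : set X).
Hypothesis (ccs : closed_cross_section phi eta S).

Let cS : closed S. Proof. by case: ccs. Qed.

Let eta0 : 0 < eta. Proof. by case: ccs => _ []. Qed.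

Lemma cross_section_inj (z z' : X) (u : R) : S z -> S z' -> `|u| <= eta ->
  phi u z = z' -> u = 0.
Proof.
move=> Sz Sz' u_eta uz; case: ccs => _ [_ /(_ (u, z) (0, z'))] /= inj.
have [] : (u, z) = (0, z'); last by [].
apply: inj; rewrite ?act0//; apply/mem_set; split => //=.
  by rewrite in_itv/= -ler_norml.
by rewrite in_itv/= oppr_le0 ltW.
Qed.

(** A quantitative form of [cross_section_inj]: where [|u| >= e] the distance from [phi u z] to [z']
    is positive, and compactness bounds it from below. *)
Lemma cross_section_near (e : R) : 0 < e -> exists2 r : R, 0 < r &
  forall z z' u, S z -> S z' -> `|u| <= eta -> mdist (phi u z) z' < r -> `|u| < e.
Proof.
move=> e0.
have cK : compact (`[- eta, eta]%classic `*` (S `*` S)).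
  apply: compact_setX; first exact: segment_compact.
  by apply: compact_setX; exact: closed_sub_compact.
have [|r r0 rP] := @compact_small R _ _ (fun r (p : R * (X * X)) =>
    mdist (phi p.1 p.2.1) p.2.2 < r -> `|p.1| < e) cK.
  move=> [u [z z']] [/= uI [Sz Sz']].
  have [ue|eu] := ltP `|u| e.
    exists 1 => //; exists (ball u (e - `|u|), setT) => /=.
      split; first by apply: nbhsx_ballx; rewrite subr_gt0.
      exact: filterT.
    move=> [u' [y y']] [/= uu' _] q _ _ _.
    rewrite -(subrK u u') (le_lt_trans (ler_normD _ _))// -ltrBrDr distrC.
    exact: uu'.
  have d0 : 0 < mdist (phi u z) z'.
    rewrite mdist_gt0; apply/eqP => uz.
    have u0 : u = 0.
      by apply: cross_section_inj uz => //; rewrite ler_norml; move: uI; rewrite in_itv.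
    by move: eu; rewrite u0 normr0 leNgt e0.
  set d := mdist _ _ in d0.
  have d30 : 0 < d / 3 by rewrite divr_gt0.
  have [r r0 rP] := flow_near u z d30.
  exists (d / 3) => //.
  exists (ball u r, [set p | mdist z p.1 < r /\ mdist z' p.2 < d / 3]) => /=.
    split; first exact: nbhsx_ballx.
    exists ([set y | mdist z y < r], [set y | mdist z' y < d / 3]) => //=.
    by split; apply/nbhs_mdistE; [exists r|exists (d / 3)].
  move=> [u' [y y']] [/= uu' [zy zy']] q q0 qd uy.
  exfalso; have : d < d; last by rewrite ltxx.
  rewrite {1}/d (le_lt_trans (metric_triangle _ (phi u' y) _))//.
  have a1 := rP _ _ uu' zy.
  have a2 := metric_triangle (phi u' y) y' z'.
  rewrite (metric_sym y') in a2.
  by rewrite -/d in a1 a2 *; lra.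
exists r => // z z' u Sz Sz' ue uz; apply: (rP (u, (z, z')) r) => //.
by split => //=; rewrite in_itv/= -ler_norml.
Qed.

Lemma closed_flow_boundary : closed (flow_boundary phi eta S).
Proof.
have -> : flow_boundary phi eta S =
    S `&` ~` (orbit_segments phi (- eta) eta S)^°.
  rewrite /flow_boundary /flow_interior -(closure_id S).1// setDE setCI setIUr.
  by rewrite setICr setU0.
by apply: closedI => //; apply: open_closedC; exact: open_interior.
Qed.

(** The points of [S] at distance at least [q] from the flow boundary form a compact subset of the
    interior of the flow box, so a nearby [y'] is still in the box; [cross_section_near] makes its
    time of return to [S] small. *)
Lemma cross_section_hit (q s : R) : 0 < q -> 0 < s -> exists2 r : R, 0 < r &
  forall y y', S y -> q <= tdist (flow_boundary phi eta S) y ->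
    mdist y y' < r -> exists2 t, `|t| < s & S (phi t y').
Proof.
move=> q0 s0; set B := flow_boundary phi eta S.
pose K := S `&` [set y | q <= tdist B y].
have cK : compact K.
  apply: closed_sub_compact; apply: closedI => //.
  apply: (@closed_comp _ _ (tdist B) [set x | q <= x]); last exact: closed_ge.
  by move=> x _; apply: lipschitz_cont => ? ?; exact: tdist_lipschitz.
have KO : K `<=` (orbit_segments phi (- eta) eta S)^°.
  move=> y [Sy qy]; apply: contrapT => ny.
  have By : B y by split; [exact: subset_closure|case].
  by move: qy; rewrite /= tdist_eq0// leNgt q0.
have [r r0 rP] := compact_open_nbhs cK (@open_interior _ _) KO.
have [r' r'0 r'P] := cross_section_near s0.
exists (Num.min r r'); first by rewrite lt_min r0.
move=> y y' Sy qy; rewrite lt_min => /andP[yr yr'].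
have /interior_subset [t tI [a Sa E]] := rP y y' (conj Sy qy) yr.
exists (- t); last by rewrite -E flowK.
rewrite normrN; apply: (r'P a y) => //.
  by rewrite ler_norml; move: tI; rewrite /= in_itv.
by rewrite E metric_sym.
Qed.

End cross_section.
End compact_flow.

(** * Local cross-sections *)

Section local_cross_section.
Variables (R : realType) (X : metricType R) (cX : compact [set: X]).
Variable phi : flow R X.

Lemma mdist_triangle_norm (x y z : X) : `|mdist x y - mdist x z| <= mdist y z.
Proof.
have := metric_triangle x z y; have := metric_triangle x y z.
rewrite (metric_sym z y) ler_norml => ? ?.
by apply/andP; split; lra.
Qed.

(* [F y], the supremum of [- M d(x, u y) - u] over [|u| <= a], is a local time
   function: for large [M] and [y] close to [x] the supremum is not approached
   near [u = a] and [u = - a], so that shifting [y] along its orbit by [t]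
   changes [F] by exactly [t]. *)
Lemma local_time_function (x : X) : (exists t, phi t x <> x) ->
  exists F : X -> R, continuous F /\ exists2 r, 0 < r & forall y t,
    mdist x y < r -> mdist x (phi t y) < r -> `|t| <= r -> F (phi t y) = F y + t.
Proof.
move=> [a' a'x].
have [a [a0 ax amx]] : exists a, [/\ 0 < a, phi a x <> x & phi (- a) x <> x].
  have N t : phi t x <> x -> phi (- t) x <> x.
    by move=> tx E; apply: tx; rewrite -{1}E flowNK.
  have a'0 : a' != 0 by apply/eqP => E; apply: a'x; rewrite E act0.
  exists `|a'|; split; first by rewrite normr_gt0.
    by have [_|_] := ler0P a'; [exact: N|].
  by have [_|_] := ler0P a'; [rewrite opprK|exact: N].
pose d := Num.min (mdist x (phi a x)) (mdist x (phi (- a) x)).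
have d0 : 0 < d.
  by rewrite lt_min !mdist_gt0; apply/andP; split; apply/eqP => /esym.
have d20 : 0 < d / 2 by rewrite divr_gt0.
have [r1 r10 far] : exists2 r1, 0 < r1 & forall y s, mdist x y < r1 ->
    `|a - s| < r1 \/ `|- a - s| < r1 -> d / 2 < mdist x (phi s y).
  have [r1 r10 r1P] := flow_near phi a x d20.
  have [r2 r20 r2P] := flow_near phi (- a) x d20.
  exists (Num.min r1 r2); first by rewrite lt_min r10.
  move=> y s; rewrite !lt_min => /andP[xy1 xy2] [/andP[s1 _]|/andP[_ s2]].
    have := r1P _ _ s1 xy1; have := metric_triangle x (phi s y) (phi a x).
    have : d <= mdist x (phi a x) by rewrite ge_min lexx.
    by rewrite (metric_sym (phi s y)); lra.
  have := r2P _ _ s2 xy2; have := metric_triangle x (phi s y) (phi (- a) x).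
  have : d <= mdist x (phi (- a) x) by rewrite ge_min lexx orbT.
  by rewrite (metric_sym (phi s y)); lra.
(* With this [M] the penalty near [u = a] and [u = - a] exceeds [2 * (a + 1)], which puts the value
   there below the one at [u = 0]. *)
pose M := 4 * (a + 1) / d.
have M0 : 0 < M by rewrite divr_gt0// mulr_gt0// addr_gt0.
have Md : M * (d / 2) = 2 * (a + 1) by rewrite /M; field; rewrite gt_eqF.
clearbody M.
pose h y u := - (M * mdist x (phi u y)) - u.
pose E y := [set h y u | u in [set u | `|u| <= a]].
pose F y := sup (E y).
have Ene y : E y !=set0 by exists (h y 0), 0 => //=; rewrite normr0 ltW.
have Eub y : has_ubound (E y).
  exists a => _ [u /= ua <-]; rewrite /h.
  have := mulr_ge0 (ltW M0) (mdist_ge0 x (phi u y)).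
  by move: ua; rewrite ler_norml => /andP[]; lra.
have hF y u : `|u| <= a -> h y u <= F y.
  by move=> ua; apply: ub_le_sup; [exact: Eub|exists u].
exists F; split.
  move=> y; apply/(@cvgrPdist_le _ R^o) => e e0.
  have [r r0 rP] := flow_equicont cX phi a (divr_gt0 e0 M0).
  apply/nbhs_mdistE; exists r => // z yz.
  have H y1 y2 : mdist y1 y2 < r -> F y1 <= F y2 + e.
    move=> y12; apply: ge_sup => // _ [u /= ua <-].
    apply: le_trans (_ : h y2 u + e <= _); last by rewrite lerD2r hF.
    have /ltW := rP u _ _ ua y12; rewrite ler_pdivlMr// => H.
    have := mdist_triangle_norm x (phi u y1) (phi u y2).
    rewrite -(ler_pM2l M0) => /le_trans; rewrite [M * mdist _ _]mulrC => /(_ _ H).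
    rewrite -[X in X * _](gtr0_norm M0) -normrM mulrBr ler_norml /h => /andP[].
    lra.
  by rewrite ler_distl lerBlDr; apply/andP; split; apply: H => //; rewrite metric_sym.
pose r := Num.min (r1 / 2) (Num.min 1 M^-1).
have r0 : 0 < r by rewrite !lt_min divr_gt0// ltr01 invr_gt0 M0.
(* The reverse inequality follows by applying this one to [phi t y] and [- t]. *)
have half y t : mdist x y < r -> `|t| <= r -> F (phi t y) <= F y + t.
  rewrite !lt_min !le_min => /and3P[xy1 _ xyM] /and3P[t1 t11 _].
  have r1h : r1 / 2 < r1 by rewrite ltr_pdivrMr// ltr_pMr// ltr1n.
  apply: ge_sup => // _ [u /= ua <-].
  have -> : h (phi t y) u = h y (u + t) + t by rewrite /h actD; lra.
  rewrite lerD2r.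
  have [uta|uta] := leP `|u + t| a; first exact: hF.
  apply: le_trans (hF y 0 _); last by rewrite normr0 ltW.
  have close : `|a - (u + t)| < r1 \/ `|- a - (u + t)| < r1.
    move: ua t1 uta; rewrite !ler_norml real_ltr_normr ?num_real// => /andP[u1 u2] /andP[t2 t3] /orP[ut|ut]; [left|right];
      by rewrite ltr_norml; apply/andP; split; lra.
  have := far y _ (lt_trans xy1 r1h) close.
  rewrite -(ltr_pM2l M0) Md /h act0.
  move: xyM; rewrite -[_ < _](ltr_pM2l M0) mulfV ?gt_eqF//.
  by move: ua t11; rewrite !ler_norml => /andP[u1 u2] /andP[t2 t3]; lra.
exists r => // y t xy xty tr; apply/eqP; rewrite eq_le half//=.
have := @half (phi t y) (- t) xty; rewrite normrN flowK => /(_ tr).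
lra.
Qed.

(** The section is a level set of the local time function inside a closed ball around [x]. Time
    increases by exactly [t] along an orbit, so the level is not met twice within time [r], and a
    nearby [z] reaches it after time [F x - F z]. *)
Lemma local_cross_section (x : X) : (exists t, phi t x <> x) ->
  exists eta S, closed_cross_section phi eta S /\ flow_interior phi eta S x.
Proof.
move=> /local_time_function [F [Fc [r r0 rF]]].
have r20 : 0 < r / 2 by rewrite divr_gt0.
have r2r : r / 2 < r by rewrite ltr_pdivrMr// ltr_pMr// ltr1n.
pose S := [set y | mdist x y <= r / 2] `&` [set y | F y = F x].
exists (r / 2), S.
have Sx : S x by split => //=; rewrite mdistxx ltW.
split; first split; [|split=> //|].
- apply: closedI.
    apply: (@closed_comp _ _ (mdist x) [set z | z <= r / 2]); last exact: closed_le.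
    by move=> y _; apply: lipschitz_cont => ? ?; exact: mdist_triangle_norm.
  by apply: (@closed_comp _ _ F [set F x]) => [y _|]; [exact: Fc|exact: closed_eq].
- move=> [t y] [t' y'] /set_mem [/= tI [xy Fy]] /set_mem [/= t'I [xy' Fy']] tty.
  have E : phi (t - t') y = y' by rewrite addrC actD tty flowK.
  have := rF y (t - t') (le_lt_trans xy r2r).
  rewrite E => /(_ (le_lt_trans xy' r2r)).
  move: tI t'I; rewrite !in_itv/= => /andP[t1 t2] /andP[t3 t4].
  have -> : `|t - t'| <= r by rewrite ler_norml; apply/andP; split; lra.
  move=> /(_ isT); rewrite Fy Fy' => H.
  have tt' : t = t' by lra.
  by move: E; rewrite tt' subrr act0 => ->.
- split => //.
  have [r' r'0 r'P] := flow_near phi 0 x r20.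
  have m0 : 0 < Num.min (r / 2) r' by rewrite lt_min r20.
  have : \forall z \near x, `|F x - F z| < Num.min (r / 2) r'.
    by move: (Fc x) => /(@cvgrPdist_lt _ R^o); exact.
  have : \forall z \near x, mdist x z < Num.min r r'.
    by apply/nbhs_mdistE; exists (Num.min r r'); rewrite ?lt_min ?r0.
  rewrite /interior/=; apply: filterS2 => z.
  rewrite !lt_min => /andP[xz xz'] /andP[Fxz Fxz'].
  have xFz : mdist x (phi (F x - F z) z) < r / 2.
    by rewrite -{1}(act0 phi x) r'P// sub0r normrN.
  exists (- (F x - F z)).
    by rewrite /= in_itv/= -ler_norml normrN ltW.
  exists (phi (F x - F z) z); last exact: flowK.
  split; first exact: ltW.
  rewrite /= rF//; first by rewrite addrC subrK.
    exact: lt_trans r2r.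
  by rewrite ltW// (lt_trans Fxz).
Qed.

Lemma flow_interior_tdist (eta : R) (S : set X) (x : X) :
  closed_cross_section phi eta S -> flow_interior phi eta S x ->
  0 < tdist (flow_boundary phi eta S) x.
Proof.
move=> ccs xi; apply: tdist_gt0; first exact: closed_flow_boundary ccs.
by case=> _; exact.
Qed.

(** By [cross_section_hit] a point near [x] reaches [S] in so short a time that the hit is within
    [e] of [x]; hence [x] stays in the flow interior after the intersection with the ball. *)
Lemma cross_section_restrict (eta : R) (S : set X) (x : X) (e : R) : 0 < e ->
  closed_cross_section phi eta S -> flow_interior phi eta S x ->
  let S' := S `&` [set y | mdist x y <= e] in
  closed_cross_section phi eta S' /\ flow_interior phi eta S' x.
Proof.
move=> e0 ccs xi S'.
have [cS [eta0 inj]] := ccs.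
split.
  split; [|split=> //].
    apply: closedI => //.
    apply: (@closed_comp _ _ (mdist x) [set z | z <= e]); last exact: closed_le.
    by move=> y _; apply: lipschitz_cont => ? ?; exact: mdist_triangle_norm.
  by move=> p p' /set_mem [pI [Sp _]] /set_mem [p'I [Sp' _]]; apply: inj; exact/mem_set.
have Sx : S x by case: xi.
have [s s0 sP] := flow_near phi 0 x e0.
have m0 : 0 < Num.min s eta by rewrite lt_min s0.
have [r r0 rP] := cross_section_hit cX ccs (flow_interior_tdist ccs xi) m0.
split; last by split=> //=; rewrite mdistxx ltW.
apply/nbhs_mdistE; exists (Num.min r s); first by rewrite lt_min r0.
move=> y; rewrite lt_min => /andP[xyr xys].
have [t] := rP x y Sx (lexx _) xyr; rewrite lt_min => /andP[ts te] St.
exists (- t); first by rewrite /= in_itv/= -ler_norml normrN ltW.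
exists (phi t y); last exact: flowK.
split=> //=; rewrite ltW// -{1}(act0 phi x) sP// sub0r normrN//.
Qed.

End local_cross_section.

(** * Measures from contents on closed sets *)

(** A normalized content in the sense of measure theory. It is a total function on sets, but only
    its values on closed sets are constrained. *)
Record closed_content (R : realType) (X : topologicalType) := ClosedContent {
  content :> set X -> R ;
  content_ge0 : forall C, closed C -> 0 <= content C ;
  le_content : forall C D, closed C -> closed D -> C `<=` D ->
    content C <= content D ;
  content_setU : forall C D, closed C -> closed D ->
    content (C `|` D) <= content C + content D ;
  content_disjoint : forall C D, closed C -> closed D -> C `&` D = set0 ->
    content C + content D <= content (C `|` D) ;
  content_setT : content setT = 1 }.

Section content_measure.
Variables (R : realType) (X : metricType R) (cX : compact [set: X]).
Variable m : closed_content R X.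

(** Applied to open sets; [outer_content] then extends it to all sets, as in the classical passage
    from a content to a regular Borel measure. *)
Definition inner_content (G : set X) : R :=
  sup [set m C | C in [set C | closed C /\ C `<=` G]].

Definition outer_content (A : set X) : R :=
  inf [set inner_content G | G in [set G | open G /\ A `<=` G]].

Lemma content0 : m set0 = 0.
Proof.
apply/eqP; rewrite eq_le content_ge0 ?andbT; last exact: closed0.
have := @content_disjoint _ _ m set0 set0 closed0 closed0 (setI0 _).
by rewrite setU0; lra.
Qed.

Let inner_ne G : [set m C | C in [set C | closed C /\ C `<=` G]] !=set0.
Proof. by exists (m set0), set0 => //; split; [exact: closed0|]. Qed.

Lemma le_inner_content C G : closed C -> C `<=` G -> m C <= inner_content G.
Proof.
move=> cC CO; apply: ub_le_sup; last by exists C.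
exists 1 => _ [D [cD _] <-]; rewrite -(content_setT m).
by apply: le_content => //; exact: closedT.
Qed.

Lemma inner_content_le G b : (forall C, closed C -> C `<=` G -> m C <= b) ->
  inner_content G <= b.
Proof. by move=> H; apply: ge_sup => // _ [C [cC CO] <-]; exact: H. Qed.

Lemma inner_content_ge0 G : 0 <= inner_content G.
Proof. by rewrite -content0 le_inner_content//; exact: closed0. Qed.

Let outer_ne A : [set inner_content G | G in [set G | open G /\ A `<=` G]] !=set0.
Proof. by exists (inner_content setT), setT => //; split; [exact: openT|]. Qed.

Lemma outer_content_le A G : open G -> A `<=` G -> outer_content A <= inner_content G.
Proof.
move=> oO AO; apply: ge_inf; last by exists G.
by exists 0 => _ [W _ <-]; exact: inner_content_ge0.
Qed.

Lemma le_outer_content A b :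
  (forall G, open G -> A `<=` G -> b <= inner_content G) -> b <= outer_content A.
Proof. by move=> H; apply: lb_le_inf => // _ [G [oO AO] <-]; exact: H. Qed.

Lemma outer_content_lt A b : outer_content A < b ->
  exists G, [/\ open G, A `<=` G & inner_content G < b].
Proof. by move=> /inf_lt => /(_ (outer_ne _)) [_ [G [oO AO] <-] Ob]; exists G. Qed.

Lemma outer_content_ge0 A : 0 <= outer_content A.
Proof. by apply: le_outer_content => G _ _; exact: inner_content_ge0. Qed.

Lemma outer_content_mono A B : A `<=` B -> outer_content A <= outer_content B.
Proof.
move=> AB; apply: le_outer_content => G oO BO; apply: outer_content_le => //.
exact: subset_trans BO.
Qed.

Lemma outer_content0 : outer_content set0 = 0.
Proof.
apply/eqP; rewrite eq_le outer_content_ge0 andbT.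
apply: le_trans (outer_content_le open0 (@subset_refl _ _)) _.
by apply: inner_content_le => C _; rewrite subset0 => ->; rewrite content0.
Qed.

Lemma outer_contentT : outer_content setT = 1.
Proof.
apply/eqP; rewrite eq_le; apply/andP; split.
  apply: le_trans (outer_content_le openT (@subset_refl _ _)) _.
  apply: inner_content_le => C cC _; rewrite -(content_setT m).
  by apply: le_content => //; exact: closedT.
apply: le_outer_content => G _ TO; rewrite -(content_setT m).
by apply: le_inner_content => //; exact: closedT.
Qed.

Let tdist_closed (A B : set X) : closed [set y | tdist A y <= tdist B y].
Proof.
rewrite (_ : mkset _ = (fun y => tdist B y - tdist A y) @^-1` [set x | 0 <= x]).
  apply: closed_comp; last exact: closed_ge.
  move=> y _; apply: continuousB; apply: lipschitz_cont => ? ?;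
  exact: tdist_lipschitz.
by apply/seteqP; split => y /=; rewrite subr_ge0.
Qed.

(** A closed set covered by two open sets splits into two closed pieces, one inside each, by
    comparing the distances to the two complements. *)
Lemma content_le_sum (G : nat -> set X) n C : (forall i, open (G i)) ->
  closed C -> C `<=` \big[setU/set0]_(i < n) G i ->
  m C <= \sum_(i < n) inner_content (G i).
Proof.
move=> oO; elim: n C => [|n IH] C cC.
  by rewrite !big_ord0 subset0 => ->; rewrite content0.
rewrite !big_ord_recr/=; set P := \big[_/_]_(i < n) _ => CPO.
have oP : open P.
  by rewrite /P; elim/big_ind: _ => //; [exact: open0|exact: openU].
pose C1 := C `&` [set y | tdist (~` G n) y <= tdist (~` P) y].
pose C2 := C `&` [set y | tdist (~` P) y <= tdist (~` G n) y].
have cC1 : closed C1 by exact: closedI.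
have cC2 : closed C2 by exact: closedI.
have sep (U V : set X) y : open U -> open V -> (U `|` V) y ->
    tdist (~` U) y <= tdist (~` V) y -> V y.
  move=> oU oV UVy; have [//|nV] := pselect (V y).
  have Uy : U y by case: UVy.
  rewrite (tdist_eq0 nV) leNgt tdist_gt0//; exact: open_closedC.
have -> : C = C1 `|` C2.
  rewrite -setIUr; apply/seteqP; split => [y Cy|y []//].
  by split => //; have [|/ltW] := leP (tdist (~` G n) y) (tdist (~` P) y); [left|right].
apply: le_trans (content_setU m cC1 cC2) _; apply: lerD.
  apply: IH => // y [Cy yP]; apply: sep yP => //.
  by rewrite setUC; exact: CPO.
apply: le_inner_content => // y [Cy yO]; apply: sep yO => //.
exact: CPO.
Qed.

Let mus (A : set X) : \bar R := (outer_content A)%:E.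

(** A closed subset of the union is compact, hence inside a finite union, where [content_le_sum]
    applies. *)
Lemma inner_content_bigcup (G : nat -> set X) : (forall i, open (G i)) ->
  ((inner_content (\bigcup_i G i))%:E <= \sum_(i <oo) (inner_content (G i))%:E)%E.
Proof.
move=> oO; set s := (\sum_(i <oo) _)%E.
have [soo|] := eqVneq s +oo%E; first by rewrite soo leey.
have s0 : (0 <= s)%E.
  by apply: nneseries_ge0 => n _ _; rewrite lee_fin inner_content_ge0.
move=> soo; have sfin : s \is a fin_num by rewrite ge0_fin_numE// ltey.
rewrite -(fineK sfin) lee_fin; apply: inner_content_le => C cC CO.
have [n Cn] : exists n, C `<=` \big[setU/set0]_(i < n) G i.
  have /compact_near_coveringP cov := closed_sub_compact cX cC.
  have := cov nat (\oo%classic) (fun n x => (\big[setU/set0]_(i < n) G i) x) _.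
  case=> [x /CO [i _ Oix]|n _ nP]; last by exists n; apply: nP => /=.
  exists (G i, [set n | (i < n)%N]) => /=.
    split; first by apply: open_nbhs_nbhs; split.
    by exists i.+1.
  by move=> [y n] /= [Oy i_n]; rewrite -bigcup_mkord; exists i.
rewrite -lee_fin fineK//.
apply: (@le_trans _ _ (\sum_(i < n) inner_content (G i))%:E).
  by rewrite lee_fin content_le_sum.
rewrite -sumEFin -(big_mkord xpredT (fun i => (inner_content (G i))%:E)).
by apply: nneseries_lim_ge => i _ _; rewrite lee_fin inner_content_ge0.
Qed.

Lemma outer_content_sigma_subadditive : sigma_subadditive mus.
Proof.
move=> A; apply/lee_addgt0Pr => e e0.
apply: (@le_trans _ _ (\sum_(i <oo) (mus (A i) + (e / (2 ^ i.+1)%:R)%:E)))%E; last first.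
  apply: epsilon_trick; last exact: ltW.
  by move=> n; rewrite lee_fin outer_content_ge0.
have /choice [G OP] : forall n, exists G, [/\ open G, A n `<=` G &
    inner_content G < outer_content (A n) + e / (2 ^ n.+1)%:R].
  by move=> n; apply: outer_content_lt; rewrite ltrDl divr_gt0// ltr0n expn_gt0.
have oO i : open (G i) by case: (OP i).
apply: le_trans (le_trans (inner_content_bigcup oO) _).
  rewrite lee_fin; apply: outer_content_le; first exact: bigcup_open.
  by move=> x [i _ Ax]; exists i => //; case: (OP i) => _ AO _; exact: AO.
apply: lee_nneseries => i _; first by rewrite lee_fin inner_content_ge0.
by rewrite lee_fin ltW//; case: (OP i).
Qed.

(* The proof of compactness is an argument only for the sake of the inference of
   the structures built on this function. *)
Definition content_outer_measure (c : compact [set: X]) (A : set X) : \bar R :=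
  (outer_content A)%:E.

Local Notation mu := (content_outer_measure cX).

Let mu0 : mu set0 = 0%E.
Proof. by rewrite /content_outer_measure outer_content0. Qed.

Let mu_ge0 A : (0 <= mu A)%E.
Proof. by rewrite lee_fin outer_content_ge0. Qed.

Let le_mu : {homo mu : A B / A `<=` B >-> (A <= B)%E}.
Proof. by move=> A B AB; rewrite lee_fin outer_content_mono. Qed.

HB.instance Definition _ := isOuterMeasure.Build R X mu
  mu0 mu_ge0 le_mu outer_content_sigma_subadditive.

(** Inside an open [W] containing [A], a closed [C] in [W]&[G] is chosen first and a closed [D] in
    [W]\[C] second. They are disjoint, so their contents add up to at most the inner content of
    [W]. *)
Lemma open_caratheodory (G : set X) : open G ->
  caratheodory_measurable mu G.
Proof.
move=> oG; apply: le_caratheodory_measurable => A.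
rewrite -EFinD lee_fin; apply: le_outer_content => W oW AW.
have AGW : outer_content (A `&` G) <= inner_content (W `&` G).
  by apply: outer_content_le; [exact: openI|exact: setSI].
apply: le_trans (lerD AGW (lexx _)) _; rewrite -lerBrDr.
apply: inner_content_le => C cC CWG; rewrite lerBrDr -lerBrDl.
have oWC : open (W `\` C) by rewrite setDE; apply: openI => //; exact: closed_openC.
apply: (@le_trans _ _ (inner_content (W `\` C))).
  apply: outer_content_le => // x [Ax nGx]; split; first exact: AW.
  by move=> /CWG [].
apply: inner_content_le => D cD DWC; rewrite lerBrDl.
apply: le_trans (content_disjoint m cC cD _) _.
  by rewrite -subset0 => x [Cx /DWC []].
apply: le_inner_content; first exact: closedU.
by move=> x [/CWG []|/DWC []].
Qed.

Variable x0 : X.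

Definition content_probability (A : set (borel x0)) : \bar R :=
  mu (A : set X).

Let borel_caratheodory (A : set (borel x0)) : measurable A ->
  caratheodory_measurable mu A.
Proof.
pose M := mu : set (pointed_at x0) -> \bar R.
have : <<s @open (pointed_at x0) >> `<=` M.-cara.-measurable.
  apply: smallest_sub; last exact: open_caratheodory.
  split => //; [by move=> B mB; rewrite setTD; exact: measurableC |
                by move=> u_ mu_; exact: bigcupT_measurable].
exact.
Qed.

Let cp0 : content_probability set0 = 0%E.
Proof. exact: mu0. Qed.

Let cp_ge0 A : (0 <= content_probability A)%E.
Proof. exact: mu_ge0. Qed.

Let cp_sigma_additive : semi_sigma_additive content_probability.
Proof.
move=> F mF tF mUF.
apply: (@caratheodory_measure_sigma_additive R (pointed_at x0) mu) => //.
  by move=> i; exact: borel_caratheodory.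
exact: borel_caratheodory.
Qed.

HB.instance Definition _ := isMeasure.Build _ (borel x0) R content_probability
  cp0 cp_ge0 cp_sigma_additive.

Let cpT : content_probability setT = 1%E.
Proof.
by rewrite /content_probability /content_outer_measure outer_contentT.
Qed.

HB.instance Definition _ :=
  Measure_isProbability.Build _ (borel x0) R content_probability cpT.

End content_measure.

(** * Occupation times of null sets *)

(** The pushforward agrees with Lebesgue measure on half-open intervals, which determine the
    latter. *)
Lemma lebesgue_measure_translate (R : realType) (s : R) (A : set R) :
  measurable A ->
  lebesgue_measure ((fun t => s + t) @^-1` A) = lebesgue_measure A.
Proof.
have mf : measurable_fun setT (fun t : R => s + t : R).
  by apply: measurable_funD => //; exact: measurable_cst.
move=> mA.
pose mu := pushforward (@lebesgue_measure R)
   (fun t : measurableTypeR R => s + t : measurableTypeR R).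
suff : lebesgue_measure A = mu A by move=> ->.
apply: (@lebesgue_measure_unique R mu) => // _ [[a b] _ <-].
transitivity (lebesgue_measure (`](a - s), (b - s)]%classic : set R)).
  rewrite !lebesgue_measure_itv/= !lte_fin ltrD2r.
  by case: ifPn => // _; rewrite -!EFinD; congr EFin; lra.
congr lebesgue_measure.
by apply/seteqP; split => t /=; rewrite !in_itv/= => /andP[? ?]; apply/andP; split; lra.
Qed.

Section occupation.
Variables (R : realType) (X : metricType R).
Variable phi : flow R X.

Definition visits (N : R) (x : X) (C : set X) : set R :=
  `[0, N]%classic `&` [set t | C (phi t x)].

Definition occupation (N : R) (x : X) (C : set X) : R :=
  fine (lebesgue_measure (visits N x C)).

Lemma closed_visits N x C : closed C -> closed (visits N x C).
Proof.
move=> cC; apply: closedI; first exact: itv_closed.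
by apply: (@closed_comp _ _ (phi^~ x)) => // t _; exact: orbit_cont.
Qed.

Lemma measurable_visits N x C : closed C -> measurable (visits N x C).
Proof. by move=> cC; apply: closed_measurable; exact: closed_visits. Qed.

Lemma occupationE N x C : closed C ->
  lebesgue_measure (visits N x C) = (occupation N x C)%:E.
Proof.
move=> cC; rewrite fineK// ge0_fin_numE//.
apply: (@le_lt_trans _ _ (lebesgue_measure `[0, N]%classic)).
  apply: le_measure; rewrite ?inE; last exact: subIsetl.
    exact: measurable_visits.
  exact: measurable_itv.
by rewrite lebesgue_measure_itv/=; case: ifPn => // _; rewrite -EFinD ltry.
Qed.

Lemma occupation_ge0 N x C : 0 <= occupation N x C.
Proof. by rewrite fine_ge0. Qed.

Lemma occupation_mono N x C D : closed C -> closed D -> C `<=` D ->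
  occupation N x C <= occupation N x D.
Proof.
move=> cC cD CD; rewrite -lee_fin -!occupationE//.
apply: le_measure; rewrite ?inE; [exact: measurable_visits..|].
by apply: setIS => t; exact: CD.
Qed.

Lemma occupation_setU N x C D : closed C -> closed D ->
  occupation N x (C `|` D) <= occupation N x C + occupation N x D.
Proof.
move=> cC cD; rewrite -lee_fin EFinD -!occupationE//; last exact: closedU.
rewrite (_ : visits N x (C `|` D) = visits N x C `|` visits N x D).
  by apply: measureU2; exact: measurable_visits.
by rewrite -setIUr.
Qed.

Lemma occupation_disjoint N x C D : closed C -> closed D -> C `&` D = set0 ->
  occupation N x C + occupation N x D <= occupation N x (C `|` D).
Proof.
move=> cC cD CD; rewrite -lee_fin EFinD -!occupationE//; last exact: closedU.
rewrite (_ : visits N x (C `|` D) = visits N x C `|` visits N x D).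
  rewrite measureU//; [exact: measurable_visits..|].
  rewrite -subset0 => t [[_ Ct] [_ Dt]].
  by have : (C `&` D) (phi t x) by []; rewrite CD.
by rewrite -setIUr.
Qed.

Lemma occupation_setT N x : 0 <= N -> occupation N x setT = N.
Proof.
move=> N0; apply: EFin_inj; rewrite -occupationE; last exact: closedT.
rewrite (_ : visits N x setT = `[0, N]%classic).
  rewrite lebesgue_measure_itv/= lte_fin; case: ifPn; first by rewrite sube0.
  by rewrite -leNgt => N0'; congr EFin; apply: le_anti; rewrite N0.
by rewrite /visits; apply/seteqP; split => [t []|t]//.
Qed.

Lemma occupation_le N x C : 0 <= N -> closed C -> occupation N x C <= N.
Proof.
move=> N0 cC; rewrite -[leRHS](occupation_setT x N0).
by apply: occupation_mono => //; exact: closedT.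
Qed.

(** Shifting time by [s] moves visits out of [[0, N]] only into two intervals of length [|s|] at its
    ends. The error does not depend on [N] and vanishes in time averages. *)
Lemma occupation_shift s N x C : closed C ->
  occupation N x (phi s @^-1` C) <= occupation N x C + 2 * `|s|.
Proof.
move=> cC.
have cC' : closed (phi s @^-1` C) by apply: closed_comp => // y _; exact: flow_cont.
pose B1 : set R := `[- `|s|, 0]%classic.
pose B2 : set R := `[N, N + `|s|]%classic.
pose B := B1 `|` B2.
have mB : measurable B by apply: measurableU; exact: measurable_itv.
have Bs : (lebesgue_measure B <= (2 * `|s|)%:E)%E.
  apply: (@le_trans _ _ (lebesgue_measure B1 + lebesgue_measure B2)%E).
    by apply: measureU2; exact: measurable_itv.
  have itvs a b : b - a = `|s| -> (lebesgue_measure (`[a, b]%classic : set R) <= `|s|%:E)%E.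
    move=> ab; rewrite lebesgue_measure_itv/=; case: ifPn => _; last by rewrite lee_fin.
    by rewrite -EFinB ab.
  rewrite mulr_natl mulr2n EFinD; apply: leeD; apply: itvs; lra.
rewrite -lee_fin EFinD -!occupationE//.
apply: (@le_trans _ _ (lebesgue_measure ((fun t => s + t) @^-1` (visits N x C `|` B)))).
  have mV : measurable (visits N x C `|` B) by apply: measurableU => //; exact: measurable_visits.
  apply: le_measure; rewrite ?inE; first exact: measurable_visits.
    rewrite -[X in measurable X]setTI.
    have mf : measurable_fun setT (fun t : R => s + t : R).
      by apply: measurable_funD => //; exact: measurable_cst.
    exact: mf.
  move=> t [/=]; rewrite in_itv/= => /andP[t0 tN].
  rewrite -actD => Cst; have [/andP st|] := boolP ((0 <= s + t) && (s + t <= N)).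
    by left; split => //=; rewrite in_itv/=; apply/andP.
  rewrite negb_and -!ltNge => /orP[st|st]; right; [left|right];
    rewrite /B1 /B2 /= in_itv/=; have := ler_norm s; have := ler_norm (- s);
    rewrite normrN => ? ?; apply/andP; split; lra.
rewrite lebesgue_measure_translate; last first.
  by apply: measurableU => //; exact: measurable_visits.
apply: (@le_trans _ _ (lebesgue_measure (visits N x C) + lebesgue_measure B)%E).
  by apply: measureU2 => //; exact: measurable_visits.
by rewrite leeD2l.
Qed.

End occupation.

Lemma ultra_cvg (T : Type) (U : set_system T) (Y : topologicalType) (K : set Y)
    (f : T -> Y) : UltraFilter U -> compact K -> (forall t, K (f t)) ->
  exists p : Y, f @ U --> p.
Proof.
move=> FU cK Kf.
have [p [_ clp]] : K `&` cluster (f @ U) !=set0.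
  by apply: cK; apply: (@filterE _ U _ (f @^-1` K)) => t; exact: Kf.
exists p => V pV.
have [//|UV] := in_ultra_setVsetC (f @^-1` V) FU.
by have [y []] := clp (~` V) V UV pV.
Qed.

Section null_sets.
Variables (R : realType) (X : metricType R) (cX : compact [set: X]).
Variable phi : flow R X.

(** An invariant content induces an invariant Borel probability measure, to which the nullity of [F]
    applies; [x0] is the base point of the Borel structure. *)
Lemma null_content (m : closed_content R X) (F : set X) (x0 : X) :
  (forall t C, closed C -> m (phi t @^-1` C) = m C) -> null phi F ->
  outer_content m F = 0.
Proof.
move=> minv nullF.
have clo t C : closed C -> closed (phi t @^-1` C).
  by move=> cC; apply: closed_comp => // y _; exact: flow_cont.
have opn t G : open G -> open (phi t @^-1` G).
  by move=> cG; apply: open_comp => // y _; exact: flow_cont.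
have half t A : outer_content m (phi t @^-1` A) <= outer_content m A.
  apply: le_outer_content => G oG AG.
  apply: le_trans (outer_content_le m (opn t _ oG) _) _.
    by move=> x; exact: AG.
  apply: inner_content_le => C cC CG.
  rewrite -(minv (- t))//; apply: le_inner_content; first exact: clo.
  by move=> x /CG /=; rewrite flowNK.
have inv : @invariant_measure R X phi x0 (content_probability cX m (x0:=x0)).
  move=> t A _; congr EFin; apply/eqP; rewrite eq_le half/=.
  have {1}-> : A = phi (- t) @^-1` (phi t @^-1` A).
    by apply/seteqP; split => y /=; rewrite flowNK.
  exact: half.
have [B [mB B0 FB]] := nullF x0 _ inv.
apply/eqP; rewrite eq_le outer_content_ge0 andbT.
have <- : outer_content m B = 0 by exact: EFin_inj B0.
exact: outer_content_mono.
Qed.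

(** Otherwise ever longer orbit pieces spend a proportion above [delta] of their time in shrinking
    neighbourhoods of [F]. The ultrafilter limit of their occupation frequencies is an invariant
    content giving each neighbourhood at least [delta], whereas by [null_content] some open set
    around [F] has inner content below [delta]. *)
Lemma null_occupation (F : set X) : closed F -> null phi F ->
  forall delta : R, 0 < delta -> exists r N0 : R, [/\ 0 < r, 0 < N0 &
    forall N x, N0 <= N ->
      occupation phi N x [set y | tdist F y <= r] <= delta * N].
Proof.
move=> cF nullF delta delta0; apply: contrapT => H.
(* The radii are below 1, where a bound on [tdist] yields an actual nearby point of [F]. *)
pose Fn (n : nat) : set X := [set y | tdist F y <= n.+2%:R^-1].
have cFn n : closed (Fn n).
  apply: (@closed_comp _ _ (tdist F) [set z | z <= _]); last exact: closed_le.
  by move=> y _; apply: lipschitz_cont => ? ?; exact: tdist_lipschitz.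
have /choice [p pP] : forall n : nat, exists p : R * X, n.+1%:R <= p.1 /\
    delta * p.1 < occupation phi p.1 p.2 (Fn n).
  move=> n; apply: contrapT => Hn; apply: H; exists n.+2%:R^-1, n.+1%:R.
  split => //.
  move=> N x nN; rewrite leNgt; apply/negP => lt; apply: Hn.
  by exists (N, x).
have p0 n : 0 < (p n).1.
  by have [pn _] := pP n; apply: lt_le_trans pn; rewrite ltr0n.
have [U [FU ooU]] := ultraFilterLemma (@eventually_filter).
pose f C n := occupation phi (p n).1 (p n).2 C / (p n).1.
(* Frequencies lie in [[0, 1]], so they converge along the ultrafilter; the value 0 on sets that are
   not closed is arbitrary. *)
have /choice [m mP] : forall C : set X, exists l : R, closed C -> f C @ U --> l.
  move=> C; have [cC|ncC] := pselect (closed C); last by exists 0.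
  have [|l fl] := @ultra_cvg _ U R `[0, 1]%classic (f C) FU (@segment_compact _ 0 1).
    move=> n; rewrite /f /= in_itv/=; apply/andP; split.
      by rewrite divr_ge0 ?occupation_ge0// ltW.
    by rewrite ler_pdivrMr// mul1r occupation_le// ltW.
  by exists l.
have m_ge0 C : closed C -> 0 <= m C.
  move=> cC; apply: cvgr_to_ge (mP _ cC) _; apply: filterE => n.
  by rewrite divr_ge0 ?occupation_ge0// ltW.
have le_m C D : closed C -> closed D -> C `<=` D -> m C <= m D.
  move=> cC cD CD; apply: ler_cvg_to (mP _ cC) (mP _ cD) _.
  apply: filterE => n; rewrite ler_pM2r ?invr_gt0//.
  exact: occupation_mono.
have m_setU C D : closed C -> closed D -> m (C `|` D) <= m C + m D.
  move=> cC cD.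
  apply: ler_cvg_to (mP _ (closedU cC cD)) (cvgD (mP _ cC) (mP _ cD)) _.
  apply: filterE => n; rewrite /f /= -mulrDl ler_pM2r ?invr_gt0//.
  exact: occupation_setU.
have m_disj C D : closed C -> closed D -> C `&` D = set0 -> m C + m D <= m (C `|` D).
  move=> cC cD CD.
  apply: ler_cvg_to (cvgD (mP _ cC) (mP _ cD)) (mP _ (closedU cC cD)) _.
  apply: filterE => n; rewrite /f /= -mulrDl ler_pM2r ?invr_gt0//.
  exact: occupation_disjoint.
have mT : m setT = 1.
  apply: cvg_unique (mP _ closedT) _ => //.
  have -> : f setT = cst 1.
    by apply/funext => n; rewrite /f occupation_setT ?divff ?gt_eqF// ltW.
  exact: cvg_cst.
pose M := ClosedContent m_ge0 le_m m_setU m_disj mT.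
have minv_le t C : closed C -> m (phi t @^-1` C) <= m C.
  move=> cC.
  have cC' : closed (phi t @^-1` C) by apply: closed_comp => // y _; exact: flow_cont.
  apply/ler_addgt0Pr => e e0.
  apply: ler_cvg_to (mP _ cC') (cvgD (mP _ cC) (cvg_cst e)) _.
  apply: ooU; exists (Num.truncn (2 * `|t| / e)) => // n /= tn.
  change (f (phi t @^-1` C) n <= f C n + e).
  rewrite /f -[e](@mulfK _ (p n).1) ?gt_eqF//.
  rewrite -mulrDl ler_pM2r ?invr_gt0//.
  apply: le_trans (occupation_shift _ _ _ _ cC) _; rewrite lerD2l.
  rewrite [leRHS]mulrC -ler_pdivrMr//.
  have [pn _] := pP n; apply: le_trans pn; apply/ltW.
  by apply: lt_le_trans (truncnS_gt _) _; rewrite ler_nat.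
have minv t C : closed C -> M (phi t @^-1` C) = M C.
  move=> cC; apply/eqP; rewrite eq_le minv_le//=.
  have cC' : closed (phi t @^-1` C) by apply: closed_comp => // y _; exact: flow_cont.
  have {1}-> : C = phi (- t) @^-1` (phi t @^-1` C).
    by apply/seteqP; split => y /=; rewrite flowNK.
  exact: minv_le.
have := null_content (p 0%N).2 minv nullF.
move=> F0; have : outer_content M F < delta by rewrite F0.
move=> /outer_content_lt [G [oG FG Gd]].
have [r r0 rP] := compact_open_nbhs (closed_sub_compact cX cF) oG FG.
pose k := Num.truncn r^-1.
have kr : k.+2%:R^-1 < r.
  rewrite -[ltRHS]invrK ltf_pV2 ?posrE ?invr_gt0 ?ltr0n//.
  by apply: lt_trans (truncnS_gt _) _; rewrite ltr_nat.
have FkG : Fn k `<=` G.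
  move=> y Fky; have [||z Fz yz] := @tdist_lt _ _ F y (Num.min r 1).
  - by rewrite ge_min lexx orbT.
  - apply: le_lt_trans Fky _; rewrite lt_min kr/= invf_lt1 ?ltr0n//.
    by rewrite ltr1n.
  - apply: (rP z y Fz); rewrite metric_sym; apply: lt_le_trans yz _.
    by rewrite ge_min lexx.
have : delta <= m (Fn k).
  apply: cvgr_to_ge (mP _ (cFn k)) _.
  apply: ooU; exists k => // n /= kn.
  rewrite /f ler_pdivlMr//; have [_ /ltW pn] := pP n; apply: le_trans pn _.
  apply: occupation_mono => // y; rewrite /Fn /= => /le_trans; apply.
  by rewrite lef_pV2 ?posrE ?ltr0n// ler_nat.
have := le_inner_content M (cFn k) FkG; rewrite /=; lra.
Qed.

End null_sets.

(** * Following hits along chains of good points *)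

Inductive chain (T : Type) (r : T -> T -> Prop) (x : T) : T -> Prop :=
| chain_refl : chain r x x
| chain_step y z : chain r x y -> r y z -> chain r x z.

Lemma chain_trans (T : Type) (r : T -> T -> Prop) (x y z : T) :
  chain r x y -> chain r y z -> chain r x z.
Proof. by move=> xy; elim=> // u v _ xu uv; exact: chain_step xu uv. Qed.

Lemma chain_sym (T : Type) (r : T -> T -> Prop) (x y : T) :
  (forall x y, r x y -> r y x) -> chain r x y -> chain r y x.
Proof.
move=> rs; elim=> [|u v _ ux uv]; first exact: chain_refl.
exact: chain_trans (chain_step (chain_refl r v) (rs _ _ uv)) ux.
Qed.

Lemma chain_map (T T' : Type) (r : T -> T -> Prop) (r' : T' -> T' -> Prop)
    (f : T -> T') (x y : T) :
  (forall x y, r x y -> r' (f x) (f y)) -> chain r x y -> chain r' (f x) (f y).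
Proof.
move=> rr'; elim=> [|u v _ xu uv]; first exact: chain_refl.
exact: chain_step xu (rr' _ _ uv).
Qed.

(** With both ends in [G] the relation is symmetric. In the tracking argument the goodness of the
    source lets hits be followed, that of the target keeps them off the cuts. *)
Definition near_step (R : realType) (X : metricType R) (G : set X) (k : R)
  (x y : X) := [/\ G x, G y & mdist x y < k].

Section tracking.
Variables (R : realType) (X : metricType R) (cX : compact [set: X]).
Variable phi : flow R X.

(** A tube lemma: the time interval is compact and the complement of [Q] is open. *)
Lemma open_avoid (a b : R) (Q : set (R * X)) : closed Q ->
  open [set x | forall t, a <= t -> t <= b -> ~ Q (t, phi t x)].
Proof.
move=> cQ; rewrite openE => x xP.
have /compact_near_coveringP cov := @segment_compact R a b.
have UP : \forall y \near x, `[a, b]%classic `<=` (fun t => ~ Q (t, phi t y)).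
  apply: cov => t.
  rewrite /= in_itv/= => /andP[ta tb].
  have : nbhs (t, phi t x) (~` Q).
    by apply: open_nbhs_nbhs; split; [exact: closed_openC|exact: xP].
  case=> -[/= A B] [tA xB] AB.
  have /nbhs_mdistE [e e0 eB] := xB.
  have [r r0 rP] := flow_near phi t x e0.
  exists (A `&` ball t r, [set y | mdist x y < r]) => /=.
    split; first by apply: filterI => //; exact: nbhsx_ballx.
    by apply/nbhs_mdistE; exists r.
  move=> [s y] /= [[As ts] xy]; apply: AB; split => //=.
  by apply: eB; exact: rP.
apply: filterS UP => y Uy t ta tb; apply: (Uy t).
by rewrite /= in_itv/= ta.
Qed.

Variables (I : finType) (S : I -> set X) (g : I -> X -> R) (T : set X).
Variables (L : R).

Definition integer_set : set (R^o : metricType R) := range (@intmul R 1).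

(* [q] is the threshold of the colour on [g] and [v] its shift on the time axis,
   whose unit is [e0]; [th] is the margin in both conditions. *)
Definition good (q v e0 th : R) : set X := [set x |
  (forall t i, - 8 <= t -> t <= L + 8 -> S i (phi t x) ->
    th < `|g i (phi t x) - q|) /\
  (forall t, - 8 <= t -> t <= 8 -> T (phi t x) ->
    th < tdist integer_set (t / e0 - v : R^o))].

Definition good_step (q v e0 th k : R) : X -> X -> Prop :=
  near_step (good q v e0 th) k.

Definition hit (q : R) (x : X) (t : R) (i : I) :=
  S i (phi t x) /\ q < g i (phi t x).

Hypothesis g_lipschitz : forall i x y, `|g i x - g i y| <= mdist x y.
Hypothesis closed_S : forall i, closed (S i).
Hypothesis closed_T : closed T.

Lemma open_good q v e0 th : open (good q v e0 th).
Proof.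
pose Q1 i : set (R * X) := [set p | (S i `&` [set y | `|g i y - q| <= th]) p.2].
pose Q2 : set (R * X) :=
  [set p | tdist integer_set (p.1 / e0 - v : R^o) <= th /\ T p.2].
have cQ1 i : closed (Q1 i).
  apply: (@closed_comp _ _ (@snd R X)); first by move=> p _; exact: cvg_snd.
  apply: closedI => //.
  apply: (@closed_comp _ _ (fun y => `|g i y - q|) [set z | z <= th]); last exact: closed_le.
  move=> y _; apply: lipschitz_cont => {}y z.
  apply: (le_trans (ler_dist_dist _ _)).
  by rewrite opprB addrA subrK g_lipschitz.
have cQ2 : closed Q2.
  rewrite (_ : Q2 = (@fst R X) @^-1` [set t | tdist integer_set (t / e0 - v : R^o) <= th]
      `&` (@snd R X) @^-1` T)//.
  apply: closedI; last first.
    by apply: closed_comp => // p _; exact: cvg_snd.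
  apply: closed_comp; first by move=> p _; exact: cvg_fst.
  pose h t := tdist integer_set (t / e0 - v : R^o).
  apply: (@closed_comp _ _ h [set z | z <= th]); last exact: closed_le.
  move=> t _; apply: (@continuous_comp _ _ _ (fun t : R => (t / e0 - v : R)) (tdist integer_set)).
    by apply: cvgB; [apply: cvgM; [exact: cvg_id|exact: cvg_cst]|exact: cvg_cst].
  by apply: (@lipschitz_cont R (R^o : metricType R)) => ? ?; exact: tdist_lipschitz.
rewrite openE => x [x1 x2].
have n1 : \forall y \near x, forall i t, - 8 <= t -> t <= L + 8 -> ~ Q1 i (t, phi t y).
  apply: (@filter_forall X I (fun i y =>
    forall t, - 8 <= t -> t <= L + 8 -> ~ Q1 i (t, phi t y)) (nbhs x)) => i.
  apply: open_nbhs_nbhs; split; first exact: open_avoid.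
  by move=> t t1 t2 [/= St]; rewrite leNgt x1.
have n2 : \forall y \near x, forall t, - 8 <= t -> t <= 8 -> ~ Q2 (t, phi t y).
  apply: open_nbhs_nbhs; split; first exact: open_avoid.
  by move=> t t1 t2 [/= + Tt]; rewrite leNgt x2.
rewrite /interior /=; apply: filterS2 n1 n2 => y y1 y2; split.
  by move=> t i t1 t2 St; rewrite ltNge; apply/negP => le; apply: (y1 i t).
by move=> t t1 t2 Tt; rewrite ltNge; apply/negP => le; apply: (y2 t).
Qed.

Lemma floor_margin (a b d : R) : (forall z : int, d < `|a - z%:~R|) -> `|a - b| <= d ->
  Num.floor a = Num.floor b.
Proof.
move=> da ab; apply/esym/floor_def.
have := da (Num.floor a); have := da (Num.floor a + 1).
have /andP[] := floor_itv a; rewrite intrD/= => f1 f2.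
rewrite ltr0_norm ?subr_lt0// ger0_norm ?subr_ge0// => d1 d2.
by move: ab; rewrite ler_norml => /andP[ab1 ab2]; apply/andP; split; lra.
Qed.

Hypothesis S_hit : forall i (q s : R), 0 < q -> 0 < s -> exists2 r : R, 0 < r &
  forall y y', S i y -> q <= g i y -> mdist y y' < r ->
    exists2 t, `|t| < s & S i (phi t y').

(** Goodness of [x] turns [q < g] into [q + th < g] at the hit. Passing to the orbit of [y] costs
    less than [th / 2], and so does moving along it back to the section; the result is still above
    [q]. *)
Lemma good_step_hit (th e0 s : R) : 0 < th -> 0 < s -> exists2 k, 0 < k &
  forall q v x y t i, 0 <= q -> good_step q v e0 th k x y -> hit q x t i ->
    - 7 <= t -> t <= L + 7 -> exists2 t', `|t' - t| < s & hit q y t' i.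
Proof.
move=> th0 s0.
have [r1 r10 r1P] := flow_time_cont cX phi (divr_gt0 th0 (ltr0Sn R 1)).
have sr0 : 0 < Num.min s r1 by rewrite lt_min s0.
have /choice [r rP] : forall i, exists r : R, 0 < r /\ forall y y', S i y -> th <= g i y -> mdist y y' < r ->
      exists2 t, `|t| < Num.min s r1 & S i (phi t y').
  by move=> i; have [r r0 rP] := S_hit i th0 sr0; exists r.
pose r2 := Num.min (th / 2) (\big[Num.min/1]_i r i).
have r20 : 0 < r2.
  rewrite lt_min divr_gt0//=; apply: lt_bigmin; first exact: ltr01.
  by move=> i _; case: (rP i).
have [k k0 kP] := flow_equicont cX phi (`|L| + 7) r20.
exists k => // q v x y t i q0 [gx gy xy] [St qg] t1 t2.
have tL : `|t| <= `|L| + 7.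
  by rewrite ler_norml; apply/andP; split; have := ler_norm L; have := normr_ge0 L; lra.
have := kP t x y tL xy; rewrite lt_min => /andP[d1 d2].
have thg : q + th < g i (phi t x).
  have /(_ _ _ St) := proj1 gx t i; rewrite gtr0_norm ?subr_gt0//.
  by move=> H; rewrite -ltrBrDl H//; lra.
have [||s' s'P Ss'] := (proj2 (rP i)) (phi t x) (phi t y) St.
- lra.
- by apply: lt_le_trans d2 _; exact: bigmin_le_cond.
move: s'P; rewrite lt_min => /andP[s's s'r].
exists (s' + t); first by rewrite addrK.
split; rewrite actD//.
have := r1P s' (phi t y) s'r.
have := g_lipschitz i (phi t x) (phi t y).
have := g_lipschitz i (phi t y) (phi s' (phi t y)).
rewrite (metric_sym (phi t y)) !ler_norml => /andP[_ a1] /andP[_ a2]; lra.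
Qed.

Variables (rho eta e es eps e0 : R).
Hypothesis S_sub_T : forall i, S i `<=` T.
Hypothesis S_gap : forall x, exists t i,
  [/\ `|t| <= 2, S i (phi t x) & rho <= g i (phi t x)].
Hypothesis S_return : forall i j y y' D D', S i y -> S i y' ->
  S j (phi D y) -> S j (phi D' y') -> `|D| <= 8 -> `|D' - D| <= eta ->
  `|D' - D| < e.
Hypothesis S_near : forall i y y' s, S i y -> S i y' -> `|s| <= 2 ->
  mdist (phi s y) (phi s y') < eps / 2.
Hypothesis time_near : forall s y, `|s| <= es -> mdist (phi s y) y < eps / 2.
Hypotheses (eta0 : 0 < eta) (e_gt0 : 0 < e) (e00 : 0 < e0) (L0 : 0 <= L).
Hypothesis e_small : e0 + e * (L + 4) <= Num.min es (Num.min (eta / 3) 1).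

(* A hit of [x] at time [t] is followed to a hit of [y] at time [t'].  In the
   initial window the colour keeps [t'] in the cell of [t].  Later on the error
   is compared with the error at an earlier hit: return times from one small
   section to another are either [e]-close or [eta]-apart, so the error
   grows by at most [e]. *)
Lemma chain_hit (th : R) : 0 < th -> exists2 k : R, 0 < k &
  forall q v x y t i, 0 <= q -> q < rho -> chain (good_step q v e0 th k) x y ->
    - 2 <= t -> t <= L + 2 -> hit q x t i ->
    exists t', [/\ hit q y t' i, `|t' - t| <= e0 + e * (t + 2) &
      t <= 6 -> Num.floor (t' / e0 - v) = Num.floor (t / e0 - v)].
Proof.
move=> th0.
(* The bound 1 keeps new hits in the time range where goodness speaks, [eta / 3] serves the
   comparison of return times, and [th * e0] is the margin around the cuts in units of time. *)
pose s := Num.min 1 (Num.min (eta / 3) (th * e0)).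
have s0 : 0 < s by rewrite !lt_min ltr01 divr_gt0//= mulr_gt0.
have [s1 s2 s3] : [/\ s <= 1, s <= eta / 3 & s <= th * e0].
  by split; rewrite /s !ge_min lexx ?orbT.
have [k k0 kP] := good_step_hit e0 th0 s0.
exists k => // q v x y t i q0 qrho xy.
elim: xy t i => [|{}y z xy IH yz] t i t1 t2 ht.
  exists t; split=> //; rewrite subrr normr0.
  have : 0 <= e * (t + 2) by apply: mulr_ge0; [exact: ltW|lra].
  by move: e00; lra.
have ebound r : - 2 <= r -> r <= L + 2 -> e0 + e * (r + 2) <= Num.min es (Num.min (eta / 3) 1).
  move=> r1 r2; apply: le_trans e_small; rewrite lerD2l ler_pM2l//; lra.
(* The hit [r'] of [y] comes from the induction on the chain, the hit [r''] of [z] from one more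
   step. For [r <= 6] the goodness of [z] keeps [r''] in the cell of [r], so errors do not
   accumulate along the chain. *)
have step r j : - 2 <= r -> r <= L + 2 -> hit q x r j -> exists r' r'',
    [/\ hit q z r'' j, `|r'' - r'| < s, `|r' - r| <= e0 + e * (r + 2) &
        r <= 6 -> `|r'' - r| <= e0 /\
          Num.floor (r'' / e0 - v) = Num.floor (r / e0 - v)].
  move=> r1 r2 hr; have [r' [hr' r'r fl]] := IH r j r1 r2 hr.
  have := le_trans r'r (ebound r r1 r2).
  rewrite !le_min => /and3P[_ _]; rewrite ler_norml => /andP[r'1 r'2].
  have [||r'' r''r' hr''] := kP _ _ _ _ _ _ q0 yz hr'; [lra|lra|].
  exists r', r''; split=> // r6.
  have fl' : Num.floor (r'' / e0 - v) = Num.floor (r' / e0 - v).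
    have : `|r'' - r'| < 1 by apply: lt_le_trans r''r' s1.
    rewrite ltr_norml => /andP[r''1 r''2].
    have [_ [_ gz] _] := yz.
    have {gz} : th < tdist integer_set (r'' / e0 - v : R^o).
      apply: gz; [lra|lra|]; apply: (@S_sub_T j); exact: hr''.1.
    move=> thz; apply: (@floor_margin _ _ th).
      move=> n; apply: lt_le_trans thz _.
      have : integer_set (n%:~R : R) by exists n.
      move=> /(@tdist_le _ (R^o : metricType R) _ (r'' / e0 - v : R^o)).
      by rewrite /mdist /= distrC.
    rewrite opprD addrACA subrr addr0 -mulrBl normrM [X in _ * X]gtr0_norm ?invr_gt0//.
    by rewrite ler_pdivrMr// (le_trans (ltW r''r')).
  split; last by rewrite fl' fl.
  have := fl r6; rewrite -fl' => {}fl.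
  have /andP[] := floor_itv (r'' / e0 - v); have /andP[] := floor_itv (r / e0 - v).
  rewrite fl intrD/= => a1 a2 a3 a4.
  have : `|r'' / e0 - r / e0| <= 1 by rewrite ler_norml; apply/andP; split; lra.
  rewrite -mulrBl normrM [X in _ * X]gtr0_norm ?invr_gt0//.
  by rewrite ler_pdivrMr// mul1r.
suff main (n : nat) : forall t i, - 2 <= t -> t <= L + 2 -> t <= 6 + n%:R ->
    hit q x t i -> exists t', [/\ hit q z t' i, `|t' - t| <= e0 + e * (t + 2) &
      t <= 6 -> Num.floor (t' / e0 - v) = Num.floor (t / e0 - v)].
  apply: (main (Num.truncn (L + 2)).+1) => //.
  have := truncnS_gt (L + 2); lra.
elim: n => [|n IHn] {}t {}i {}t1 {}t2 tn {}ht.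
  have [t' [t'' [ht'' _ _ t6]]] := step t i t1 t2 ht.
  have [|t''t fl] := t6; first by move: tn; rewrite addr0.
  exists t''; split => //; apply: le_trans t''t _.
  by rewrite lerDl; apply: mulr_ge0; [exact: ltW|lra].
have [t' [t'' [ht'' t''t' t't tfl]]] := step t i t1 t2 ht.
have [t6|t6] := leP t 6.
  have [t''t fl] := tfl t6; exists t''; split=> //; apply: le_trans t''t _.
  by rewrite lerDl; apply: mulr_ge0; [exact: ltW|lra].
exists t''; split; [exact: ht''| |by move=> ?; lra].
(* The earlier hit [u] lies between [t - 6] and [t - 2]: early enough for the induction in time,
   with a return time of at most 6. *)
have [r [j [r2 Sr gr]]] := S_gap (phi (t - 4) x).
move: r2; rewrite ler_norml => /andP[r1 r2].
pose u := r + (t - 4).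
have hu : hit q x u j by split; rewrite /u actD//; exact: lt_le_trans gr.
have tn' : u <= 6 + n%:R by move: tn; rewrite -natr1 /u; lra.
have [||u'' [hu'' u''u _]] := IHn u j _ _ tn' hu; [rewrite /u; lra..|].
have tb := ebound t t1 t2; have ub : e0 + e * (u + 2) <= Num.min es (Num.min (eta / 3) 1).
  by apply: ebound; rewrite /u; lra.
move: tb ub; rewrite !le_min => /and3P[_ tb _] /and3P[_ ub _].
(* Three errors of at most [eta / 3] each: at [t], at [u], and in the last step of the chain. *)
have close : `|(t'' - u'') - (t - u)| <= eta.
  move: (le_trans t't tb) (le_trans u''u ub) (le_trans (ltW t''t') s2).
  rewrite !ler_norml => /andP[? ?] /andP[? ?] /andP[? ?].
  by apply/andP; split; lra.
have : `|(t'' - u'') - (t - u)| < e.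
  apply: (@S_return j i (phi u x) (phi u'' z)) => //.
  - exact: hu.1.
  - exact: hu''.1.
  - by rewrite -actD subrK; exact: ht.1.
  - by rewrite -actD subrK; exact: ht''.1.
  - by rewrite ler_norml /u; apply/andP; split; lra.
(* Since [u + 1 <= t], the bound at [t] absorbs the new increment [e]. *)
have ut : e * (u + 1) <= e * t by rewrite ler_pM2l// /u; lra.
move: u''u; rewrite !ler_norml ltr_norml => /andP[? ?] /andP[? ?].
by apply/andP; split; lra.
Qed.

(** Within time 2 of [u] the orbit of [x] has a hit of depth at least [rho], above every threshold
    [q]. It is followed to a hit of [y] on the same small section, and flowing back by [r] compares
    the points at time [u] up to the drift. *)
Lemma chain_mesh (th : R) : 0 < th -> exists2 k : R, 0 < k &
  forall q v x y u, 0 <= q -> q < rho -> chain (good_step q v e0 th k) x y ->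
    0 <= u -> u <= L -> mdist (phi u x) (phi u y) < eps.
Proof.
move=> /chain_hit [k k0 kP]; exists k => // q v x y u q0 qrho xy u0 uL.
have [r [i [r2 Sr gr]]] := S_gap (phi u x).
move: r2; rewrite ler_norml => /andP[r1 r2].
have ht : hit q x (r + u) i by split; rewrite actD//; exact: lt_le_trans gr.
have [||t' [[St' _] t't _]] := kP q v x y (r + u) i q0 qrho xy _ _ ht; [lra|lra|].
rewrite [ltRHS]splitr.
apply: le_lt_trans (metric_triangle _ (phi (- r) (phi t' y)) _) _.
apply: ltrD.
  have -> : phi u x = phi (- r) (phi (r + u) x) by rewrite -actD addKr.
  by apply: (@S_near i) => //; [exact: ht.1|rewrite normrN ler_norml r1].
have -> : phi (- r) (phi t' y) = phi (t' - (r + u)) (phi u y).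
  by rewrite -!actD; congr (phi _ y); lra.
apply: time_near; apply: le_trans t't _.
have : e0 + e * (r + u + 2) <= e0 + e * (L + 4) by rewrite lerD2l ler_pM2l//; lra.
by move=> /le_trans; apply; apply: le_trans e_small _; rewrite ge_min lexx.
Qed.

End tracking.

(** * Families of cross-sections *)

(** A packing bound: the intervals of length [h] starting at the chosen times are disjoint and lie
    in [A]. *)
Lemma separated_card (R : realType) (n : nat) (P : pred 'I_n) (tau : 'I_n -> R)
    (h : R) (A : set R) : 0 < h -> measurable A ->
  (forall i j, P i -> P j -> i != j -> h < `|tau i - tau j|) ->
  (forall i t, P i -> tau i <= t -> t < tau i + h -> A t) ->
  ((#|P|%:R * h)%:E <= lebesgue_measure A)%E.
Proof.
move=> h0 mA sep PA.
pose F i : set R := `[tau i, tau i + h[%classic.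
have mF i : P i -> measurable (F i) by move=> _; exact: measurable_itv.
have dF : trivIset [set` P] F.
  move=> i j /= Pi Pj [t [/=]]; rewrite /F /= !in_itv/= => /andP[i1 i2] /andP[j1 j2].
  apply/eqP/negPn/negP => ij; have := sep i j Pi Pj ij.
  by rewrite real_ltr_normr ?num_real// => /orP[]; lra.
apply: (@le_trans _ _ (lebesgue_measure (\big[setU/set0]_(i < n | P i) F i))).
  rewrite (@measure_bigsetU_ord_cond _ _ _ (@lebesgue_measure R) n P F mF dF).
  rewrite (eq_bigr (fun=> h%:E)) => [|i _].
    by rewrite sumEFin sumr_const mulr_natl.
  by rewrite /F [LHS](lebesgue_measure_itv `[tau i, (tau i + h)[)/= lte_fin ltrDl h0 -EFinB [_ + h]addrC addrK.
apply: le_measure; rewrite ?inE//; first exact: bigsetU_measurable.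
by elim/big_ind: _ => [t []|U V UA VA t [/UA|/VA]|i Pi t] //; rewrite /F /= in_itv/= => /andP[]; exact: PA.
Qed.

Section cross_section_families.
Variables (R : realType) (X : metricType R) (cX : compact [set: X]).
Variable phi : flow R X.

Lemma closed_cross_section_sub (eta : R) (S S' : set X) : closed S' -> S' `<=` S ->
  closed_cross_section phi eta S -> closed_cross_section phi eta S'.
Proof.
move=> cS' S'S [_ [eta0 inj]]; split=> //; split=> // p p' /set_mem[pI Sp] /set_mem[pI' Sp'].
by apply: inj; apply/mem_set; split=> //; exact: S'S.
Qed.

Lemma local_hit (eta : R) (S : set X) (x : X) (s : R) :
  closed_cross_section phi eta S -> flow_interior phi eta S x -> 0 < s ->
  \forall y \near x, exists t, [/\ `|t| < s, S (phi t y) &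
    tdist (flow_boundary phi eta S) x / 2 <=
      tdist (flow_boundary phi eta S) (phi t y)].
Proof.
move=> ccs xi s0; have b0 := flow_interior_tdist ccs xi.
set b := tdist _ _ in b0 *; have b20 : 0 < b / 2 by rewrite divr_gt0.
have [r r0 rP] := flow_near phi 0 x b20.
have sr0 : 0 < Num.min s r by rewrite lt_min s0.
have [r' r'0 r'P] := cross_section_hit cX ccs b0 sr0.
apply/nbhs_mdistE; exists (Num.min r r'); first by rewrite lt_min r0.
move=> y; rewrite lt_min => /andP[xyr xyr'].
have [t + St] := r'P x y xi.2 (lexx _) xyr'; rewrite lt_min => /andP[ts tr].
exists t; split=> //.
have := tdist_lipschitz (flow_boundary phi eta S) x (phi t y).
have : mdist x (phi t y) < b / 2 by rewrite -{1}(act0 phi x) rP// sub0r normrN.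
by rewrite ler_norml -/b => ? /andP[_]; lra.
Qed.

Lemma tdist_flow_interior (eta : R) (S : set X) (y : X) :
  S y -> 0 < tdist (flow_boundary phi eta S) y -> flow_interior phi eta S y.
Proof.
move=> Sy b0; apply: contrapT => ny; move: b0; rewrite tdist_eq0 ?ltxx//.
by split; [exact: subset_closure|exact: ny].
Qed.

(** These sections fix the injectivity times once and for all, before the diameter of the finer
    sections is chosen. *)
Lemma coarse_family : fixed_point_free phi ->
  exists (K : nat) (Sigma : 'I_K -> set X) (eta : 'I_K -> R),
    (forall a, closed_cross_section phi (eta a) (Sigma a)) /\
    forall x, exists a t, `|t| <= 1 /\ flow_interior phi (eta a) (Sigma a) (phi t x).
Proof.
move=> fpf.
have /choice [p pP] : forall x, exists p : R * set X,
    closed_cross_section phi p.1 p.2 /\ flow_interior phi p.1 p.2 x.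
  move=> x; have [|eta [S SP]] := @local_cross_section _ _ cX phi x; last by exists (eta, S).
  apply: contrapT => H; apply: fpf; exists x => t; apply: contrapT => tx.
  by apply: H; exists t.
pose N x := [set y | exists t, `|t| <= 1 /\
  flow_interior phi (p x).1 (p x).2 (phi t y)].
have [|s [_ sN]] := @finite_nbhs_cover X setT N cX.
  move=> x _; have [ccs xi] := pP x.
  apply: filterS (local_hit ccs xi ltr01) => y [t [t1 St tb]].
  exists t; split; first exact: ltW.
  apply: tdist_flow_interior => //; apply: lt_le_trans tb.
  by rewrite divr_gt0//; exact: flow_interior_tdist ccs xi.
exists (size s), (fun a => (p (tnth (in_tuple s) a)).2), (fun a => (p (tnth (in_tuple s) a)).1).
split=> [a|x]; first by case: (pP (tnth (in_tuple s) a)).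
have [y ys [t [t1 ti]]] := sN x Logic.I.
have ys' : (index y s < size s)%N by rewrite index_mem.
exists (Ordinal ys'), t; split=> //.
by rewrite (tnth_nth y)/= nth_index.
Qed.

(** The pieces are cut out of the coarse sections and inherit their injectivity times, so [d] may
    depend on these. A time up to 1 to reach the coarse section and a local hit within time 1 give
    the bound 2. *)
Lemma fine_family (K : nat) (Sigma : 'I_K -> set X) (eta : 'I_K -> R) (d : R) :
  SFBP phi -> 0 < d ->
  (forall a, closed_cross_section phi (eta a) (Sigma a)) ->
  (forall x, exists a t, `|t| <= 1 /\ flow_interior phi (eta a) (Sigma a) (phi t x)) ->
  exists (n : nat) (S : 'I_n -> set X) (a : 'I_n -> 'I_K) (rho : R),
    [/\ (forall i, closed_cross_section phi (eta (a i)) (S i) /\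
           has_small_flow_boundary phi (eta (a i)) (S i)),
        (forall i, S i `<=` Sigma (a i)),
        (forall i y y', S i y -> S i y' -> mdist y y' < d),
        0 < rho &
        (forall x, exists t i, [/\ `|t| <= 2, S i (phi t x) &
           rho <= tdist (flow_boundary phi (eta (a i)) (S i)) (phi t x)])].
Proof.
move=> [_ sfbp] d0 ccs cov.
have d30 : 0 < d / 3 by rewrite divr_gt0.
have /choice [p pP] : forall x, exists p : 'I_K * R * set X,
    let: (a, t, U) := p in [/\ `|t| <= 1, closed U,
      U `<=` Sigma a `&` [set y | mdist (phi t x) y <= d / 3],
      flow_interior phi (eta a) U (phi t x) & has_small_flow_boundary phi (eta a) U].
  move=> x; have [a [t [t1 ti]]] := cov x.
  have [ccs' ti'] := cross_section_restrict cX d30 (ccs a) ti.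
  have [S [cS SS' Si Sb]] := sfbp _ _ _ ccs' ti'.
  by exists (a, t, S).
pose A x := (p x).1.1; pose tm x := (p x).1.2; pose P x := (p x).2.
have pQ x : [/\ `|tm x| <= 1, closed (P x),
    P x `<=` Sigma (A x) `&` [set y | mdist (phi (tm x) x) y <= d / 3],
    flow_interior phi (eta (A x)) (P x) (phi (tm x) x) &
    has_small_flow_boundary phi (eta (A x)) (P x)].
  by have := pP x; rewrite /A /tm /P; case: (p x) => [[]].
have ccP x : closed_cross_section phi (eta (A x)) (P x).
  have [_ cP PS _ _] := pQ x.
  by apply: closed_cross_section_sub (ccs (A x)) => // y /PS [].
pose b x := tdist (flow_boundary phi (eta (A x)) (P x)).
pose r x := b x (phi (tm x) x) / 2.
pose N x := [set y | exists t, [/\ `|t| <= 2, P x (phi t y) & r x <= b x (phi t y)]].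
have [|s [_ sN]] := @finite_nbhs_cover X setT N cX.
  move=> x _; have [t1 _ _ ti _] := pQ x.
  have H := local_hit (ccP x) ti ltr01.
  have := @flow_cont _ _ phi (tm x) x _ H.
  rewrite /nbhs/=; apply: filterS => y [t [t2 Pt tb]].
  exists (t + tm x); rewrite actD; split=> //.
  apply: (le_trans (ler_normD _ _)).
  by have -> : 2 = 1 + 1 :> R by []; apply: lerD => //; exact: ltW.
pose I := 'I_(size s); pose pt (i : I) := tnth (in_tuple s) i.
exists (size s), (fun i => P (pt i)), (fun i => A (pt i)), (\big[Num.min/1]_i r (pt i)); split.
- by move=> i; split; [exact: ccP|case: (pQ (pt i))].
- by move=> i y; have [_ _ PS _ _] := pQ (pt i); move=> /PS [].
- move=> i y y'; have [_ _ PS _ _] := pQ (pt i) => /PS [_ /= y1] /PS [_ /= y2].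
  have := metric_triangle y (phi (tm (pt i)) (pt i)) y'.
  by rewrite (metric_sym y (phi _ _)); lra.
- apply: lt_bigmin; first exact: ltr01.
  move=> i _; rewrite divr_gt0//.
  by have [_ _ _ ti _] := pQ (pt i); exact: flow_interior_tdist (ccP _) ti.
- move=> x; have [y ys [t [t2 Pt tb]]] := sN x Logic.I.
  have ys' : (index y s < size s)%N by rewrite index_mem.
  have E : pt (Ordinal ys') = y by rewrite /pt (tnth_nth y)/= nth_index.
  exists t, (Ordinal ys'); rewrite E; split=> //.
  by apply: le_trans tb; rewrite -[in leRHS]E; exact: bigmin_le_cond.
Qed.

End cross_section_families.

(** * Counting the visits of an orbit to a cross-section *)

Section visit_counts.
Variables (R : realType) (X : metricType R) (cX : compact [set: X]).
Variable phi : flow R X.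

Lemma hits_separated (eta h : R) (S : set X) (x : X) (t t' : R) :
  closed_cross_section phi eta S -> h <= eta ->
  S (phi t x) -> S (phi t' x) -> t != t' -> h < `|t - t'|.
Proof.
move=> ccs heta St St'; rewrite ltNge; apply: contra => tt'.
rewrite -subr_eq0; apply/eqP.
apply: (cross_section_inj ccs St' St); first exact: le_trans heta.
by rewrite -actD subrK.
Qed.

Lemma interval_count (n : nat) (P : pred 'I_n) (tau : 'I_n -> R) (h b : R) :
  0 < h -> 0 <= b ->
  (forall i j, P i -> P j -> i != j -> h < `|tau i - tau j|) ->
  (forall i, P i -> `|tau i| <= b) -> #|P|%:R * h <= 2 * b + h.
Proof.
move=> h0 b0 sep taub.
have := @separated_card R n P tau h `[- b, b + h]%classic h0 (measurable_itv _) sep.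
rewrite lebesgue_measure_itv/= lte_fin.
have -> : - b < b + h by lra.
rewrite -EFinB lee_fin => H; apply: (le_trans (H _)); last lra.
move=> i t /taub; rewrite ler_norml => /andP[t1 t2] t3 t4 /=.
by rewrite in_itv/=; apply/andP; split; lra.
Qed.

(** During time [h <= eta] after a visit close to the flow boundary, the orbit stays near the flow
    box of that boundary, a closed null set. Visits are [h]-separated, so their number times [h] is
    bounded by an occupation time. *)
Lemma boundary_count (eta h : R) (S : set X) (delta : R) :
  closed_cross_section phi eta S -> has_small_flow_boundary phi eta S ->
  0 < h -> h <= eta -> 0 < delta ->
  exists r N0 : R, [/\ 0 < r, 0 < N0 & forall N x n (P : pred 'I_n) (tau : 'I_n -> R),
    N0 <= N ->
    (forall i, P i -> [/\ 0 <= tau i, tau i + h <= N, S (phi (tau i) x) &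
      tdist (flow_boundary phi eta S) (phi (tau i) x) < r]) ->
    (forall i j, P i -> P j -> tau i = tau j -> i = j) ->
    #|P|%:R * h <= delta * N].
Proof.
move=> ccs sm h0 heta delta0; set B := flow_boundary phi eta S.
pose F := orbit_segments phi (- eta) eta B.
have cF : closed F.
  have -> : F = (fun p : R * X => phi p.1 p.2) @` (`[- eta, eta]%classic `*` B).
    apply/seteqP; split => y.
      by case=> t tI [z Bz <-]; exists (t, z).
    by case=> -[t z] [/= tI Bz] <-; exists t => //; exists z.
  apply: compact_closed; first exact: metric_hausdorff.
  apply: continuous_compact.
    by apply: continuous_subspaceT; exact: act_continuous.
  apply: compact_setX; first exact: segment_compact.
  by apply: closed_sub_compact => //; exact: closed_flow_boundary ccs.
have [r [N0 [r0 N00 occ]]] := null_occupation cX cF sm delta0.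
have [r' r'0 r'P] := flow_equicont cX phi eta r0.
exists (Num.min 1 r'), N0; split=> //; first by rewrite lt_min ltr01.
move=> N x n P tau N0N PP inj.
have N_ge0 : 0 <= N by apply: le_trans N0N; exact: ltW.
have cC : closed [set y | tdist F y <= r].
  apply: (@closed_comp _ _ (tdist F) [set z | z <= r]); last exact: closed_le.
  by move=> y _; apply: lipschitz_cont => ? ?; exact: tdist_lipschitz.
rewrite -lee_fin; apply: (@le_trans _ _ (occupation phi N x [set y | tdist F y <= r])%:E).
  rewrite -occupationE//; apply: separated_card => //.
  - exact: measurable_visits.
  - move=> i j Pi Pj ij.
    have [_ _ Si _] := PP i Pi; have [_ _ Sj _] := PP j Pj.
    apply: (hits_separated ccs heta Si Sj).
    by apply: contra_neq ij; exact: inj.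
  - move=> i t Pi it ti; have [i0 iN Si Bi] := PP i Pi.
    split; first by rewrite /= in_itv/=; apply/andP; split; lra.
    have [|z Bz] := tdist_lt _ Bi; first by rewrite ge_min lexx.
    rewrite lt_min => /andP[_ zr] /=.
    have tI : `|t - tau i| <= eta by rewrite ger0_norm; lra.
    have -> : phi t x = phi (t - tau i) (phi (tau i) x) by rewrite -actD subrK.
    apply: ltW; apply: le_lt_trans (r'P _ _ _ tI zr).
    apply: tdist_le; exists (t - tau i); last by exists z.
    by rewrite /= in_itv/= -ler_norml.
by rewrite lee_fin; exact: occ.
Qed.

End visit_counts.

(** * Mean dimension *)

Lemma covering_dim_geN1 (R : realType) (K : topologicalType) :
  ((-1)%:E <= @covering_dim R K)%E.
Proof.
apply: le_ereal_inf_tmp => _ [m _ <-]; rewrite lee_fin.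
by have := ler0n R m; lra.
Qed.

(** Together with an upper bound this makes the width a real number, as the convergence in
    [mdim_is0] requires. *)
Lemma Widim_geN1 (R : realType) (X : topologicalType) (d : X -> X -> R) (eps : R) :
  ((-1)%:E <= Widim d eps)%E.
Proof. by apply: le_ereal_inf_tmp => _ [K [f [_ _ _ ->]]]; exact: covering_dim_geN1. Qed.

Lemma mdim_is0 (R : realType) (X : metricType R) (phi : flow R X) :
  (forall eps delta : R, 0 < eps -> 0 < delta -> exists N1 : R,
    forall N, N1 <= N -> (Widim (dist_upto phi N) eps <= (delta * N)%:E)%E) ->
  mdim_is phi 0%E.
Proof.
move=> H; exists (fun=> 0%E) => [eps eps0|]; last exact: cvg_cst.
have bnd delta : 0 < delta -> \forall N \near +oo%R,
    0 < N /\ exists2 r : R, Widim (dist_upto phi N) eps = r%:E & `|r / N| <= delta.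
  move=> delta0; have [N1 N1P] := H eps delta eps0 delta0.
  near=> N.
  have N0 : 0 < N by near: N; apply: nbhs_pinfty_gt; exact: num_real.
  have NN1 : N1 <= N by near: N; apply: nbhs_pinfty_ge; exact: num_real.
  (* This handles the lower bound: the width may be as low as -1, and [-1 / N >= - delta]. *)
  have Nd : delta^-1 <= N by near: N; apply: nbhs_pinfty_ge; exact: num_real.
  split=> //; have := N1P N NN1; have := Widim_geN1 (dist_upto phi N) eps.
  case: (Widim _ _) => // r; rewrite !lee_fin => r1 r2; exists r => //.
  rewrite ler_norml ler_pdivlMr// ler_pdivrMr// r2 andbT.
  have : 1 <= delta * N by rewrite -ler_pdivrMl// mulr1.
  lra.
apply/fine_cvgP; split.
  apply: filterS (bnd 1 ltr01) => N [N0 [r -> _]].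
  by rewrite -EFinM.
apply/(@cvgrPdist_le _ R^o) => e e0; apply: filterS (bnd e e0) => N [N0 [r rE re]].
by rewrite /= rE -EFinM/= sub0r normrN.
Unshelve. all: by end_near. Qed.

(** Chain classes of one colour partition [G j], and each is open because [G j] is open and a point
    closer than [k] can be appended to the chain. *)
Lemma Widim_chains (R : realType) (X : metricType R) (d : X -> X -> R)
    (eps k : R) (D : nat) (G : 'I_D.+1 -> set X) :
  compact [set: X] -> 0 < k -> (forall j, open (G j)) ->
  (forall x, exists j, G j x) ->
  (forall j x y, chain (near_step (G j) k) x y -> d x y < eps) ->
  (Widim d eps <= D%:R%:E)%E.
Proof.
move=> cX k0 oG GT mesh.
have sym j x y : near_step (G j) k x y -> near_step (G j) k y x.
  by case=> Gx Gy xy; split=> //; rewrite metric_sym.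
pose cl j x : set X := [set y | chain (near_step (G j) k) x y].
have clE j x y : cl j x y -> cl j x = cl j y.
  move=> xy; apply/seteqP; split=> z; last exact: chain_trans xy.
  exact: chain_trans (chain_sym (@sym j) xy).
apply: (@Widim_coloured_cover R X d eps D (fun j => [set cl j x | x in G j])) => //.
- move=> j _ [x Gx <-]; rewrite openE => y xy.
  have Gy : G j y by elim: xy => // ? ? _ _ [].
  have nGy : \forall z \near y, G j z by apply: open_nbhs_nbhs; split.
  have nky : \forall z \near y, mdist y z < k by apply/nbhs_mdistE; exists k.
  by rewrite /interior /=; apply: filterS2 nGy nky => z Gz yz; exact: chain_step xy _.
- by move=> j _ _ z [x _ <-] [y _ <-] /clE -> /clE.
- by move=> x; have [j Gx] := GT x; exists j, (cl j x); [exists x|exact: chain_refl].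
- move=> j _ y z [x _ <-] xy xz; apply: (mesh j).
  exact: chain_trans (chain_sym (@sym j) xy) xz.
Qed.

(** * Charging bad colours to visits *)

Lemma le_sum_fibers (R : realType) (D : nat) (T : finType) (kind : 'I_D -> T)
    (c : T -> R) :
  (forall k, #|[pred j | kind j == k]|%:R <= c k) -> D%:R <= \sum_k c k.
Proof.
move=> kc; apply: (@le_trans _ _ (\sum_k #|[pred j | kind j == k]|%:R)); last exact: ler_sum.
rewrite -natr_sum ler_nat -[X in (X <= _)%N]card_ord -sum1_card.
rewrite (partition_big kind xpredT)//=.
by apply: leq_sum => k _; rewrite -sum1_card.
Qed.

(** The tolerance is a quarter of the spacing [rho / D.+1%:R] of the thresholds. *)
Lemma level_colour (R : realType) (D : nat) (rho b : R) (i j : 'I_D.+1) : 0 < rho ->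
  `|b - rho * (i%:R / D.+1%:R)| <= rho / (4 * D.+1%:R) ->
  `|b - rho * (j%:R / D.+1%:R)| <= rho / (4 * D.+1%:R) -> i = j.
Proof.
move=> rho0; have D0 : 0 < D.+1%:R :> R by rewrite ltr0n.
have half (k l : 'I_D.+1) : `|b - rho * (k%:R / D.+1%:R)| <= rho / (4 * D.+1%:R) ->
    `|b - rho * (l%:R / D.+1%:R)| <= rho / (4 * D.+1%:R) -> (k <= l)%N.
  move=> kb lb; rewrite leqNgt; apply/negP => lk.
  have kl : l%:R + 1 <= k%:R :> R by rewrite natr1 ler_nat.
  have E (n : nat) : rho * (n%:R / D.+1%:R) = (rho / D.+1%:R) * n%:R by field; rewrite gt_eqF.
  have E4 : rho / (4 * D.+1%:R) = (rho / D.+1%:R) / 4 by field; rewrite gt_eqF.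
  have c0 : 0 < rho / D.+1%:R by rewrite divr_gt0.
  move: kb lb; rewrite !E E4; set c := rho / _ in c0 *.
  rewrite -(ler_pM2l c0) mulrDr mulr1 in kl.
  by rewrite !ler_norml => /andP[? ?] /andP[? ?]; lra.
by move=> ib jb; apply/val_inj/eqP; rewrite eqn_leq !half.
Qed.

(** Cuts of different colours are at least [1 / D.+1%:R] apart modulo 1, more than twice the
    tolerance. In integers, [(i - j) + D.+1 * (z - w)] has absolute value below 1 and vanishes,
    which forces [z = w]. *)
Lemma time_colour (R : realType) (D : nat) (b th : R) (i j : 'I_D.+1) :
  th < (2 * D.+1%:R)^-1 ->
  tdist (@integer_set R) (b - i%:R / D.+1%:R : R^o) <= th ->
  tdist (@integer_set R) (b - j%:R / D.+1%:R : R^o) <= th -> i = j.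
Proof.
have D0 : 0 < D.+1%:R :> R by rewrite ltr0n.
move=> thD ib jb.
have le1 : (2 * D.+1%:R)^-1 <= 1 :> R.
  by rewrite invf_le1 ?mulr_gt0// -natrM ler1n.
have [_ [z _ <-]] := tdist_lt le1 (le_lt_trans ib thD).
have [_ [w _ <-]] := tdist_lt le1 (le_lt_trans jb thD).
rewrite /mdist/= invfM !ltr_norml => /andP[w1 w2] /andP[z1 z2].
have : `|(i%:Z - j%:Z) + D.+1%:Z * (z - w)| < 1.
  rewrite -(ltr_int R) intr_norm ltr_norml rmorph1 intrD intrM !intrB -!pmulrn.
  have D2 : D.+1%:R * (2^-1 * D.+1%:R^-1) = 2^-1 :> R by field; rewrite gt_eqF.
  have E (n : nat) : D.+1%:R * (n%:R / D.+1%:R) = n%:R :> R by field; rewrite gt_eqF.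
  rewrite -(ltr_pM2l D0) !(mulrN, mulrBr) D2 E in w1.
  rewrite -(ltr_pM2l D0) !(mulrN, mulrBr) D2 E in w2.
  rewrite -(ltr_pM2l D0) !(mulrN, mulrBr) D2 E in z1.
  rewrite -(ltr_pM2l D0) !(mulrN, mulrBr) D2 E in z2.
  by rewrite mulrBr; apply/andP; split; lra.
have := ltn_ord i; have := ltn_ord j => jD iD H.
have : z - w = 0 by nia.
by move=> zw; apply: val_inj => /=; lia.
Qed.

(** * Dividing the time axis into windows of length [L] *)

Section windows.
Variables (R : realType) (X : metricType R) (cX : compact [set: X]).
Variable phi : flow R X.

Definition all_windows (M : nat) (L : R) (G : set X) : set X :=
  [set x | forall m : 'I_M.+1, G (phi (m%:R * L) x)].

Lemma open_all_windows M L G : open G -> open (all_windows M L G).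
Proof.
move=> oG; rewrite openE => x xG.
apply: (@filter_forall X 'I_M.+1 (fun m y => G (phi (m%:R * L) y)) (nbhs x)) => m.
by apply: (@flow_cont _ _ phi (m%:R * L) x); apply: open_nbhs_nbhs; split.
Qed.

(** A time [u] in [[0, N]] lies in a window starting at some [m%:R * L]; for small [kN] the flow to
    that start maps [kN]-chains to [k]-chains in [G]. Working with [eps / 2] keeps the supremum
    strictly below [eps]. *)
Lemma all_windows_mesh (M : nat) (L k : R) : 0 < L -> 0 < k ->
  exists2 kN : R, 0 < kN & forall (G : set X) (N eps : R), 0 < eps -> 0 <= N ->
    N < M.+1%:R * L ->
    (forall x y u, chain (near_step G k) x y -> 0 <= u -> u <= L ->
      mdist (phi u x) (phi u y) < eps / 2) ->
    forall x y, chain (near_step (all_windows M L G) kN) x y ->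
      dist_upto phi N x y < eps.
Proof.
move=> L0 k0.
have [kN kN0 kNP] := flow_equicont cX phi (M%:R * L) k0.
exists kN => // G N eps eps0 N0 NM Gk x y xy.
apply: (@le_lt_trans _ _ (eps / 2)); last by rewrite ltr_pdivrMr// ltr_pMr// ltr1n.
apply: ge_sup.
  by exists (mdist (phi 0 x) (phi 0 y)), 0 => //=; rewrite in_itv/= lexx.
move=> _ [u /= uI <-]; move: uI; rewrite in_itv/= => /andP[u0 uN].
pose m := Num.truncn (u / L).
have /andP[mu um] := truncn_itv (divr_ge0 u0 (ltW L0)).
rewrite -/m in mu um.
have mM : (m < M.+1)%N.
  rewrite -(ltr_nat R); apply: le_lt_trans mu _.
  by rewrite ltr_pdivrMr//; exact: le_lt_trans NM.
have mL : 0 <= u - m%:R * L by rewrite subr_ge0 -ler_pdivlMr.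
have uL : u - m%:R * L <= L.
  by rewrite lerBlDl -[X in _ + X]mul1r -mulrDl natr1 -ler_pdivrMr// ltW.
have E z : phi u z = phi (u - m%:R * L) (phi (m%:R * L) z) by rewrite -actD subrK.
rewrite !E; apply: ltW; apply: Gk => //.
apply: chain_map xy => {}x {}y [xj yj xy]; split.
- exact: (xj (Ordinal mM)).
- exact: (yj (Ordinal mM)).
- apply: kNP => //; rewrite ger0_norm; last by rewrite mulr_ge0 ?ler0n// ltW.
  by rewrite ler_pM2r// ler_nat -ltnS.
Qed.

(* A bad colour is charged to a section [S i] visited close to the threshold, or
   to a section [Sigma a] visited in the initial part of a window close to a cut;
   each such visit is charged by a single colour. *)
Lemma surviving_colour (n K M D : nat) (S : 'I_n -> set X) (g : 'I_n -> X -> R)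
    (Sigma : 'I_K -> set X) (etas : 'I_K -> R) (eta rho L N e0 b : R) :
  (forall a, closed_cross_section phi (etas a) (Sigma a)) ->
  0 < eta -> eta <= 1 -> (forall a, eta <= etas a) -> 0 < rho -> rho <= 1 ->
  0 <= L -> M%:R * L <= N ->
  (forall i x (P : pred 'I_D.+1) tau,
    (forall j, P j -> [/\ 0 <= tau j, tau j + eta <= N + L + 17,
      S i (phi (tau j) x) & g i (phi (tau j) x) < rho]) ->
    (forall j j', P j -> P j' -> tau j = tau j' -> j = j') ->
    #|P|%:R <= b) ->
  n%:R * b + (M.+1 * K)%:R * (16 / eta + 1) < D.+1%:R ->
  forall x, exists j : 'I_D.+1, all_windows M L
    (good phi S g (\bigcup_a Sigma a) L (rho * (j%:R / D.+1%:R)) (j%:R / D.+1%:R)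
      e0 (rho / (4 * D.+1%:R))) x.
Proof.
move=> ccs eta0 eta1 eta_le rho0 rho1 L0 ML count total x.
have D0 : 0 < D.+1%:R :> R by rewrite ltr0n.
set th := rho / (4 * D.+1%:R).
pose q (j : 'I_D.+1) := rho * (j%:R / D.+1%:R).
pose v (j : 'I_D.+1) : R := j%:R / D.+1%:R.
have thD : th < (2 * D.+1%:R)^-1.
  have -> : (2 * D.+1%:R)^-1 = 2 / (4 * D.+1%:R) :> R by field; rewrite gt_eqF.
  by rewrite ltr_pM2r ?invr_gt0 ?mulr_gt0//; clear -rho1; lra.
have qth j : q j + th < rho.
  have jD : j%:R + 1 <= D.+1%:R :> R by rewrite natr1 ler_nat ltn_ord.
  have -> : q j + th = (rho / D.+1%:R) * (j%:R + 4^-1).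
    by rewrite /q /th; field; rewrite gt_eqF.
  rewrite -[ltRHS](divfK (lt0r_neq0 D0)) ltr_pM2l ?divr_gt0//.
  by apply: lt_le_trans jD; rewrite ltrD2l invf_lt1// ltr1n.
apply: contrapT => bad.
(* Each colour gets a witness of its failure. Times of the first kind are counted from
   [phi (- 8) x], hence nonnegative; those of the second kind are relative to the start of their
   window. *)
have /choice [f fP] : forall j, exists f : ('I_n + 'I_M.+1 * 'I_K) * R,
    match f.1 with
    | inl i => [/\ 0 <= f.2, f.2 <= N + L + 16, S i (phi f.2 (phi (- 8) x)) &
        `|g i (phi f.2 (phi (- 8) x)) - q j| <= th]
    | inr ma => [/\ `|f.2| <= 8, Sigma ma.2 (phi f.2 (phi (ma.1%:R * L) x)) &
        tdist (@integer_set R) (f.2 / e0 - v j : R^o) <= th]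
    end.
  move=> j.
  have [m mP] : exists m : 'I_M.+1,
      ~ good phi S g (\bigcup_a Sigma a) L (q j) (v j) e0 th (phi (m%:R * L) x).
    by apply/existsNP => H; apply: bad; exists j.
  have mN : m%:R * L <= N.
    by apply: le_trans ML; apply: ler_wpM2r => //; rewrite ler_nat -ltnS.
  have mL0 : 0 <= m%:R * L by rewrite mulr_ge0 ?ler0n// ltW.
  apply: contrapT => nf; apply: mP; split.
    move=> t i t1 t2 St; rewrite ltNge; apply/negP => gt; apply: nf.
    have E : phi (t + m%:R * L + 8) (phi (- 8) x) = phi t (phi (m%:R * L) x).
      by rewrite -!actD addrK.
    exists (inl i, t + m%:R * L + 8) => /=; rewrite E; split=> //.
      by clear -t1 mL0; lra.
    by clear -t2 mN; lra.
  move=> t t1 t2 [a _ Sa]; rewrite ltNge; apply/negP => gt; apply: nf.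
  by exists (inr (m, a), t) => /=; split=> //; rewrite ler_norml t1.
(* The number [16 / eta + 1] bounds the [eta]-separated visits during [[-8, 8]]. *)
pose c (k : 'I_n + 'I_M.+1 * 'I_K) : R := if k is inl _ then b else 16 / eta + 1.
have fibers kind : #|[pred j | (f j).1 == kind]|%:R <= c kind.
  case: kind => [i|[m a]]; rewrite /c /=.
    apply: (count i (phi (- 8) x) _ (fun j => (f j).2)).
      move=> j /= /eqP fj; have := fP j; rewrite fj => -[f0 fN Sf gf].
      split=> //; first by clear -eta1 fN; lra.
      apply: le_lt_trans (qth j).
      by move: gf; rewrite ler_norml => /andP[_]; rewrite lerBlDl.
    move=> j j' /= /eqP fj /eqP fj' E.
    have := fP j; rewrite fj => -[_ _ _]; have := fP j'; rewrite fj' -E => -[_ _ _ gj' gj].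
    exact: level_colour gj gj'.
  rewrite -(ler_pM2r eta0) mulrDl mul1r divfK ?gt_eqF//.
  have -> : 16 = 2 * 8 :> R by rewrite -natrM.
  apply: (@interval_count R D.+1 _ (fun j => (f j).2)) => //.
    move=> j j' /= /eqP fj /eqP fj' jj'.
    have := fP j; rewrite fj => -[_ Sj tj]; have := fP j'; rewrite fj' => -[_ Sj' tj'].
    apply: (hits_separated (ccs a) (eta_le a) Sj Sj').
    apply: contra_neq jj' => E; rewrite -E in tj'.
    exact: time_colour thD tj tj'.
  by move=> j /= /eqP fj; have := fP j; rewrite fj => -[].
have := le_sum_fibers fibers; apply/negP; rewrite -ltNge.
apply: le_lt_trans total.
rewrite big_sumType /= !sumr_const card_prod !card_ord.
by rewrite [n%:R * b]mulr_natl [(M.+1 * K)%:R * _]mulr_natl.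
Qed.

End windows.

(** The constants are chosen in the order [eta], [L], [e0] and [e], the fine sections, [rho'], [N1],
    and only then [D] for a given [N]. *)
Lemma Widim_dist_upto_small (R : realType) (X : metricType R) (cX : compact [set: X])
    (phi : flow R X) (eps delta : R) : SFBP phi -> 0 < eps -> 0 < delta ->
  exists N1 : R, forall N, N1 <= N ->
    (Widim (dist_upto phi N) eps <= (delta * N)%:E)%E.
Proof.
move=> sfbp eps0 delta0.
have [K [Sigma [etas [ccs cov]]]] := coarse_family cX sfbp.1.
pose eta := \big[Num.min/1]_a etas a.
have eta0 : 0 < eta.
  by apply: lt_bigmin; [exact: ltr01|move=> a _; case: (ccs a) => _ []].
have eta1 : eta <= 1 by apply: bigmin_le_id.
have eta_le a : eta <= etas a by exact: bigmin_le_cond.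
clearbody eta.
(* [C0] bounds the colours spoiled by cuts in one window, and [L] is taken so long that this costs
   at most [delta / 4] per unit of time. *)
pose C0 := K%:R * (16 / eta + 1).
have C00 : 0 <= C0 by rewrite mulr_ge0 ?ler0n// addr_ge0// divr_ge0// ltW.
pose L := 1 + 4 * C0 / delta.
have CD0 : 0 <= 4 * C0 / delta.
  by apply: divr_ge0; [exact: mulr_ge0|exact: ltW].
have L1 : 1 <= L by rewrite lerDl.
have LC : 4 * C0 <= delta * L.
  rewrite /L mulrDr mulr1 [delta * (_ / _)]mulrC divfK ?gt_eqF//; lra.
have eps20 : 0 < eps / 2 by rewrite divr_gt0.
have eps40 : 0 < eps / 2 / 2 by rewrite divr_gt0.
have [es' es'0 es'P] := flow_time_cont cX phi eps40.
pose es := es' / 2.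
have es0 : 0 < es by rewrite divr_gt0.
have time_near s y : `|s| <= es -> mdist (phi s y) y < eps / 2 / 2.
  by move=> ss; apply: es'P; apply: le_lt_trans ss _; rewrite /es; lra.
pose m0 := Num.min es (Num.min (eta / 3) 1).
have m00 : 0 < m0 by rewrite !lt_min es0 divr_gt0//= ltr01.
(* Half of the admissible drift [m0] goes to the cells, the other half to the increments over one
   window. *)
pose e0 := m0 / 2; pose e := e0 / (L + 4).
have e00 : 0 < e0 by rewrite divr_gt0.
have L40 : 0 < L + 4 by lra.
have e_gt0 : 0 < e by rewrite divr_gt0.
have e_small : e0 + e * (L + 4) <= m0.
  by rewrite /e divfK ?gt_eqF// /e0; lra.
have /choice [ra raP] : forall a, exists r : R, 0 < r /\
    forall z z' u, Sigma a z -> Sigma a z' -> `|u| <= etas a ->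
      mdist (phi u z) z' < r -> `|u| < e.
  by move=> a; have [r r0 rP] := cross_section_near cX (ccs a) e_gt0; exists r.
pose r1 := \big[Num.min/1]_a ra a.
have r10 : 0 < r1.
  by apply: lt_bigmin; [exact: ltr01|move=> a _; case: (raP a)].
(* Time 9 covers return times within [eta <= 1] of a time of size at most 8. *)
have [d1 d10 d1P] := flow_equicont cX phi 9 r10.
have [d2 d20 d2P] := flow_equicont cX phi 2 eps40.
have d0 : 0 < Num.min d1 d2 by rewrite lt_min d10.
have [n [S [al [rho [ccS SSigma Sd rho0 gap]]]]] := fine_family cX sfbp d0 ccs cov.
pose g i := tdist (flow_boundary phi (etas (al i)) (S i)).
(* With this rate the [n] sections together spoil at most [delta / 4 * (N + L + 17)] colours. *)
pose delta1 := delta * eta / (4 * n.+1%:R).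
have delta10 : 0 < delta1 by rewrite !(divr_gt0, mulr_gt0)// ltr0n.
have /choice [p pP] : forall i, exists p : R * R, [/\ 0 < p.1, 0 < p.2 &
    forall N x n (P : pred 'I_n) (tau : 'I_n -> R), p.2 <= N ->
    (forall j, P j -> [/\ 0 <= tau j, tau j + eta <= N, S i (phi (tau j) x) &
      g i (phi (tau j) x) < p.1]) ->
    (forall j j', P j -> P j' -> tau j = tau j' -> j = j') ->
    #|P|%:R * eta <= delta1 * N].
  move=> i; have [r [N0 [r0 N00 rN]]] :=
    boundary_count cX (ccS i).1 (ccS i).2 eta0 (eta_le _) delta10.
  by exists (r, N0).
(* Below [(p i).1], visits near a threshold are counted by [boundary_count]; below [rho], the visits
   given by [gap] are hits for all colours. *)
pose rho' := Num.min rho (\big[Num.min/1]_i (p i).1).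
have rho'0 : 0 < rho'.
  rewrite lt_min rho0; apply: lt_bigmin; first exact: ltr01.
  by move=> i _; case: (pP i).
have rho'p i : rho' <= (p i).1 by rewrite ge_min bigmin_le_cond ?orbT.
have rho'1 : rho' <= 1 by rewrite ge_min bigmin_le_id orbT.
have rho'rho : rho' <= rho by rewrite ge_min lexx.
clearbody rho'.
pose N1 := L + 17 + 4 * C0 / delta + \sum_i (p i).2.
have sum0 : 0 <= \sum_i (p i).2 by apply: sumr_ge0 => i _; apply: ltW; case: (pP i).
exists N1 => N N1N.
have N_L : L + 17 <= N.
  by apply: le_trans N1N; rewrite /N1; clear -CD0 sum0; lra.
have N_C : C0 <= delta / 4 * N.
  have : 4 * C0 / delta <= N.
    by apply: le_trans N1N; rewrite /N1; clear -L1 sum0; lra.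
  by rewrite ler_pdivrMr//; clear; lra.
have N_p i : (p i).2 <= N + L + 17.
  have : (p i).2 <= \sum_i (p i).2.
    rewrite (bigD1 i)//= lerDl; apply: sumr_ge0 => j _; apply: ltW; by case: (pP j).
  by move: N1N; rewrite /N1; clear -CD0 L1; lra.
have N0 : 0 < N by clear -N_L L1; lra.
pose D := Num.truncn (delta * N).
have DN : D%:R <= delta * N.
  have := truncn_itv (ltW (mulr_gt0 delta0 N0)); by case/andP.
have ND : delta * N < D.+1%:R by exact: truncnS_gt.
have D0 : 0 < D.+1%:R :> R by rewrite ltr0n.
clearbody D.
apply: (@le_trans _ _ D%:R%:E); last by rewrite lee_fin.
pose T := \bigcup_a Sigma a.
have cT : closed T.
  by apply: closed_bigcup => [|a _]; [exact: finite_finset|case: (ccs a)].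
have g_lip i x y : `|g i x - g i y| <= mdist x y by exact: tdist_lipschitz.
have cS i : closed (S i) by case: (ccS i) => [[]].
have S_hit i (q s : R) : 0 < q -> 0 < s -> exists2 r : R, 0 < r &
    forall y y', S i y -> q <= g i y -> mdist y y' < r ->
      exists2 t, `|t| < s & S i (phi t y').
  by move=> q_gt0 s_gt0; exact: (cross_section_hit cX (ccS i).1 q_gt0 s_gt0).
have S_T i : S i `<=` T by move=> y /SSigma Sy; exists (al i).
have S_gap x : exists t i, [/\ `|t| <= 2, S i (phi t x) & rho' <= g i (phi t x)].
  have [t [i [t2 St gt]]] := gap x; exists t, i; split=> //.
  exact: le_trans gt.
have S_return i j y y' B B' : S i y -> S i y' -> S j (phi B y) -> S j (phi B' y') ->
    `|B| <= 8 -> `|B' - B| <= eta -> `|B' - B| < e.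
  move=> Sy Sy' SB SB' B8 BB'.
  apply: (proj2 (raP (al j))) (SSigma _ _ SB) (SSigma _ _ SB') _ _.
    exact: le_trans BB' (eta_le _).
  rewrite -actD subrK; apply: (@lt_le_trans _ _ r1); last exact: bigmin_le_cond.
  apply: d1P.
    move: B8 (le_trans BB' eta1); rewrite !ler_norml; clear => /andP[? ?] /andP[? ?].
    by apply/andP; split; lra.
  by apply: lt_le_trans (Sd i y y' Sy Sy') _; rewrite ge_min lexx.
have S_near i y y' s : S i y -> S i y' -> `|s| <= 2 ->
    mdist (phi s y) (phi s y') < eps / 2 / 2.
  move=> Sy Sy' s2; apply: d2P => //.
  by apply: lt_le_trans (Sd i y y' Sy Sy') _; rewrite ge_min lexx orbT.
(* The margin [th] and the chain scales [k] and [kN] depend on [N], which is harmless: the width is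
   estimated for one [N] at a time. *)
pose th := rho' / (4 * D.+1%:R).
have th0 : 0 < th by rewrite divr_gt0// mulr_gt0.
have [k k0 kP] := @chain_mesh R X cX phi _ S g T L g_lip S_hit rho' eta e es
  (eps / 2) e0 S_T S_gap S_return S_near time_near eta0 e_gt0 e00 e_small th th0.
have L0 : 0 < L by exact: lt_le_trans L1.
pose M := Num.truncn (N / L).
have /andP[MN NM] := truncn_itv (divr_ge0 (ltW N0) (ltW L0)).
rewrite -/M in MN NM.
have ML : M%:R * L <= N by rewrite -ler_pdivlMr.
rewrite ltr_pdivrMr// in NM.
have [kN kN0 kNP] := all_windows_mesh cX phi M L0 k0.
pose G (j : 'I_D.+1) := good phi S g T L (rho' * (j%:R / D.+1%:R)) (j%:R / D.+1%:R) e0 th.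
apply: (@Widim_chains R X (dist_upto phi N) eps kN D (fun j => all_windows phi M L (G j))) => //.
- by move=> j; apply: open_all_windows; exact: open_good.
- apply: (@surviving_colour R X phi n K M D S g Sigma etas eta rho' L N e0
    (delta1 * (N + L + 17) / eta)) => //; first exact: ltW.
    move=> i x P tau tauP inj; rewrite ler_pdivlMr//; have [_ _ pi] := pP i.
    apply: (pi _ x _ _ tau (N_p i)) => // j /tauP [? ? ? gj]; split=> //.
    exact: lt_le_trans (rho'p i).
  apply: le_lt_trans ND.
  have part1 : n%:R * (delta1 * (N + L + 17) / eta) <= delta / 4 * (N + L + 17).
    have -> : n%:R * (delta1 * (N + L + 17) / eta) =
        n%:R / n.+1%:R * (delta / 4 * (N + L + 17)).
      by rewrite /delta1; field; rewrite !gt_eqF// ltr0n.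
    rewrite -[leRHS]mul1r ler_pM2r; last first.
      by rewrite mulr_gt0 ?divr_gt0//; clear -N0 L0; lra.
    by rewrite ler_pdivrMr ?ltr0n// mul1r ler_nat.
  have part2 : (M.+1 * K)%:R * (16 / eta + 1) <= delta / 2 * N.
    rewrite natrM -mulrA -/C0 -natr1 mulrDl mul1r.
    have b1 : M%:R * C0 <= M%:R * L * (delta / 4).
      rewrite -mulrA; apply: ler_wpM2l; first exact: ler0n.
      by clear -LC; lra.
    have b2 : M%:R * L * (delta / 4) <= N * (delta / 4) by rewrite ler_pM2r// divr_gt0.
    by clear -N_C b1 b2; lra.
  have part3 : delta / 4 * (N + L + 17) <= delta / 4 * (2 * N).
    by rewrite ler_pM2l ?divr_gt0//; clear -N_L; lra.
  by clear -part1 part2 part3; lra.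
- move=> j; apply: kNP => //; first exact: ltW.
  move=> x y u; apply: kP.
    by rewrite mulr_ge0 ?divr_ge0 ?ler0n// ltW.
  rewrite gtr_pMr// ltr_pdivrMr// mul1r ltr_nat; exact: ltn_ord.
Qed.

Theorem theorem2 (R : realType) (X : metricType R) (X_compact : compact [set: X])
  (phi : flow R X) (phi_SFBP : SFBP phi)
  (phi_aperiodic : exists tau : R, aperiodic phi tau) :
  mdim_is phi 0%E.
Proof.
apply: mdim_is0 => eps delta eps0 delta0.
exact: Widim_dist_upto_small.
Qed.
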